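(* Let $K$ be a field, $S$ a positive normal affine semigroup, $R=K[S]$, and let $m\in\mathbb{Z}_+$. Then there exist only finitely many divisor classes $c\in\operatorname{Cl}(R)$ such that a divisorial ideal $D$ of class $c$ has $\mu(D)\le m$.
   Context: Semigroups are commutative, written additively, with neutral element $0$. An affine semigroup is a finitely generated subsemigroup of some $\mathbb{Z}^n$; $\operatorname{gp}(S)$ is the group of differences of $S$. $S$ is normal if every $x\in\operatorname{gp}(S)$ with $mx\in S$ for some integer $m>0$ lies in $S$; $S$ is positive if $0$ is its only invertible element. $K[S]$ is the semigroup algebra; for $S$ normal it is a normal noetherian domain. $\operatorname{Cl}(R)$ is the divisor class group of $R$: the group of isomorphism classes of divisorial (i.e. reflexive fractional) ideals. $\mu(D)$ denotes the minimal number of generators of $D$ as an $R$-module (it depends only on the class of $D$). $\mathbb{Z}_+$ is the set of non-negative integers. *)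

(* Defs.v *)
From HB Require Import structures.
From mathcomp Require Import all_boot all_order all_algebra.
From mathcomp Require Import generic_quotient fraction.
From mathcomp Require Import finmap.
From mathcomp Require Import boolp classical_sets functions cardinality.
From mathcomp Require Import monalg.

Set Implicit Arguments.
Unset Strict Implicit.
Unset Printing Implicit Defensive.

Import Order.TTheory GRing.Theory Num.Theory.

Local Open Scope classical_set_scope.
Local Open Scope ring_scope.

Section AffineSemigroups.
Variable n : nat.
Implicit Type S : set 'rV[int]_n.

Definition affine_semigroup S : Prop :=
  exists s : seq 'rV[int]_n,
    S = [set x | exists c : 'I_(size s) -> nat, x = \sum_(i < size s) s`_i *+ c i].

Definition gp S : set 'rV[int]_n := [set x - y | x in S & y in S].

Definition normal_semigroup S : Prop :=
  forall (x : 'rV[int]_n) (m : nat), gp S x -> (0 < m)%N -> S (x *+ m) -> S x.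

Definition positive_semigroup S : Prop :=
  forall x, S x -> (exists2 y, S y & x + y = 0) -> x = 0.

Record positiveAffineSemigroup := PositiveAffineSemigroup {
  pas_set :> set 'rV[int]_n;
  pas_affine : affine_semigroup pas_set;
  pas_positive : positive_semigroup pas_set }.

End AffineSemigroups.

(* The elements of S as a commutative monomial monoid, so that {malg K[_]}
   is the semigroup algebra. [monomType] is multiplicative and requires the
   monoid to have no nontrivial invertible element, hence the positivity. *)
Section SemigroupMonoid.
Variables (n : nat) (S : positiveAffineSemigroup n).

Lemma pas0 : pas_set S 0.
Proof.
have [s ->] := pas_affine S.
by exists (fun=> 0%N); rewrite big1 // => i _; rewrite mulr0n.
Qed.

Lemma pasD (x y : 'rV[int]_n) : pas_set S x -> pas_set S y -> pas_set S (x + y).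
Proof.
have [s ->] := pas_affine S.
move=> [c ->] [d ->]; exists (fun i => (c i + d i)%N).
by rewrite -big_split /=; apply: eq_bigr => i _; rewrite mulrnDr.
Qed.

Definition elements : Type := {x : 'rV[int]_n | x \in pas_set S}.

HB.instance Definition _ := SubChoice.on elements.

Definition elements0 : elements := exist _ 0 (mem_set pas0).

Definition elementsD (x y : elements) : elements :=
  exist _ (val x + val y) (mem_set (pasD (set_mem (valP x)) (set_mem (valP y)))).

Lemma elementsDA : associative elementsD.
Proof. by move=> x y z; apply/val_inj; rewrite /= addrA. Qed.

Lemma elements0D : left_id elements0 elementsD.
Proof. by move=> x; apply/val_inj; rewrite /= add0r. Qed.

Lemma elementsD0 : right_id elements0 elementsD.
Proof. by move=> x; apply/val_inj; rewrite /= addr0. Qed.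

Lemma elementsDC : commutative elementsD.
Proof. by move=> x y; apply/val_inj; rewrite /= addrC. Qed.

Lemma elements_unit x y :
  elementsD x y = elements0 -> x = elements0 /\ y = elements0.
Proof.
move=> /(congr1 val) /= xy0.
have Sx : pas_set S (val x) := set_mem (valP x).
have Sy : pas_set S (val y) := set_mem (valP y).
split; apply/val_inj => /=; apply: (@pas_positive _ S) => //.
  by exists (val y).
by exists (val x) => //; rewrite addrC.
Qed.

HB.instance Definition _ := Choice_isMonomialDef.Build elements
  elementsDA elements0D elementsD0 elements_unit.
HB.instance Definition _ := MonomialDef_isConomialDef.Build elements elementsDC.

End SemigroupMonoid.

Definition semigroup_algebra (K : fieldType) n (S : positiveAffineSemigroup n)
  : Type := {malg K[elements S]}.

Section ClassicalInverse.
Variable R : comNzRingType.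

Definition classical_unit : {pred R} := fun x => `[< exists y : R, y * x = 1 >].

Definition classical_inv (x : R) : R := xget x [set y : R | y * x = 1].

Lemma classical_mulVx : {in classical_unit, left_inverse 1 classical_inv *%R}.
Proof.
move=> x /asboolP[y yx].
by rewrite /classical_inv; case: xgetP => [z _ //|/(_ y)].
Qed.

Lemma classical_unitP (x y : R) : y * x = 1 -> x \in classical_unit.
Proof. by move=> yx; apply/asboolP; exists y. Qed.

Lemma classical_inv_out : {in [predC classical_unit], classical_inv =1 id}.
Proof.
move=> x xU; rewrite /classical_inv; case: xgetP => // z _ zx.
by case/negP: xU; apply: classical_unitP zx.
Qed.

End ClassicalInverse.

Lemma malg_mulf_neq0 (K : fieldType) (M : conomType) (f g : {malg K[M]})
    (a b : M) : f@_a != 0 -> g@_b != 0 ->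
  (forall k l, f@_k != 0 -> g@_l != 0 -> mmul k l = mmul a b -> k = a /\ l = b) ->
  f * g <> 0.
Proof.
move=> fa gb ab fg0.
have: (f * g)@_(mmul a b) = f@_a * g@_b.
  rewrite mcoeffMl (big_fsetD1 a) /=; last by rewrite -mcoeff_neq0.
  rewrite (big_fsetD1 b) /=; last by rewrite -mcoeff_neq0.
  rewrite eqxx mulr1n.
  rewrite [X in _ + X + _]big_seq big1 => [|l]; last first.
    rewrite !inE => /andP[/eqP lb]; rewrite -mcoeff_neq0 => lg.
    by case: eqP => // /(ab _ _ fa lg)[].
  rewrite addr0 big_seq big1 ?addr0 // => k.
  rewrite !inE => /andP[/eqP ka]; rewrite -mcoeff_neq0 => kf.
  rewrite big_seq big1 // => l; rewrite -mcoeff_neq0 => lg.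
  by case: eqP => // /(ab _ _ kf lg)[].
rewrite fg0 mcoeff0 => /esym/eqP.
by rewrite mulf_eq0 (negPf fa) (negPf gb).
Qed.

(* K[S] is a domain: compare the leading terms of two elements for the
   lexicographic order on Z^n. *)
Section SemigroupAlgebraDomain.
Variables (K : fieldType) (n : nat) (S : positiveAffineSemigroup n).
Notation A := (semigroup_algebra K S).

HB.instance Definition _ := GRing.ComAlgebra.on A.

Definition lexpos (v : 'rV[int]_n) : Prop :=
  exists2 i, 0 < v 0 i & forall j : 'I_n, (j < i)%N -> v 0 j = 0.

Lemma lexposD u v : lexpos u -> lexpos v -> lexpos (u + v).
Proof.
move=> [i ui u0] [j vj v0].
case: (ltngtP i j) => [ij|ji|/val_inj ij].
- exists i => [|k ki]; first by rewrite mxE (v0 _ ij) addr0.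
  by rewrite mxE u0 // v0 ?addr0 // (ltn_trans ki).
- exists j => [|k kj]; first by rewrite mxE (u0 _ ji) add0r.
  by rewrite mxE v0 // u0 ?addr0 // (ltn_trans kj).
- subst j; exists i => [|k ki]; first by rewrite mxE addr_gt0.
  by rewrite mxE u0 // v0 ?addr0.
Qed.

Lemma lexpos_neq0 v : lexpos v -> v <> 0.
Proof. by move=> [i + _] v0; rewrite v0 mxE ltxx. Qed.

Lemma lexpos_total v : v <> 0 -> lexpos v \/ lexpos (- v).
Proof.
move=> v0.
have /existsP[i0 vi0] : [exists i, v 0 i != 0].
  apply: contra_notT v0; rewrite negb_exists => /forallP h.
  by apply/rowP => i; rewrite mxE; apply/eqP; move: (h i); rewrite negbK.
pose i := [arg min_(i < i0 | v 0 i != 0) (i : nat)].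
have [vi hi] : v 0 i != 0 /\ forall j : 'I_n, (j < i)%N -> v 0 j = 0.
  rewrite /i; case: arg_minnP => // k vk hk; split=> // j jk.
  by apply/eqP; apply: contraTT jk => /hk; rewrite -leqNgt.
case: (ltgtP (v 0 i) 0) => [lt0|gt0|eq0].
- right; exists i => [|j ji]; first by rewrite mxE oppr_gt0.
  by rewrite mxE hi // oppr0.
- by left; exists i.
- by rewrite eq0 eqxx in vi.
Qed.

Lemma lex_max (s : seq (elements S)) : s <> [::] ->
  exists2 a, a \in s & forall b, b \in s -> b <> a -> lexpos (val a - val b).
Proof.
elim: s => // x s IH _.
have [->|s0] := pselect (s = [::]).
  by exists x => [|b]; rewrite inE ?eqxx // => /eqP.
have [a as_ ha] := IH s0.
have [->|xa] := pselect (x = a).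
  exists a => [|b]; rewrite inE ?eqxx // => /orP[/eqP->//|]; exact: ha.
have /lexpos_total[ax|xa'] : val a - val x <> 0.
- by move=> /eqP; rewrite subr_eq0 => /eqP/val_inj ax; apply: xa.
- exists a => [|b]; rewrite inE ?as_ ?orbT // => /orP[/eqP->//|]; exact: ha.
- rewrite opprB in xa'; exists x => [|b]; rewrite inE ?eqxx //.
  move=> /orP[/eqP->//|bs] bx.
  have [->//|ba] := pselect (b = a).
  by rewrite -(subrKA (val a)); apply: lexposD => //; apply: ha.
Qed.

Lemma sgalg_leading (f : {malg K[elements S]}) : f <> 0 ->
  exists2 a, f@_a != 0 &
    forall b, f@_b != 0 -> b <> a -> lexpos (val a - val b).
Proof.
move=> f0.
have /lex_max[a af ha] : (msupp f : seq _) <> [::].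
  move=> supp0; apply: f0; apply/malgP => k; rewrite mcoeff0; apply/eqP.
  by rewrite mcoeff_eq0; apply/negP; rewrite -[_ \in _]/(k \in (msupp f : seq _)) supp0.
exists a => [|b]; first by rewrite mcoeff_neq0.
by rewrite mcoeff_neq0 => bf; apply: ha.
Qed.

Lemma sgalg_mulf_neq0 (f g : {malg K[elements S]}) :
  f <> 0 -> g <> 0 -> f * g <> 0.
Proof.
move=> f0 g0.
have [a fa ha] := sgalg_leading f0.
have [b gb hb] := sgalg_leading g0.
apply: (malg_mulf_neq0 fa gb) => k l kf lg kl.
have {}kl : val k + val l = val a + val b := congr1 val kl.
have [ka|ka] := pselect (k = a).
  by split=> //; apply/val_inj; move: kl; rewrite ka => /addrI.
have [lb|lb] := pselect (l = b).
  by split=> //; apply/val_inj; move: kl; rewrite lb => /addIr.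
have /lexpos_neq0[] := lexposD (ha _ kf ka) (hb _ lg lb).
by rewrite addrACA -opprD kl subrr.
Qed.

Lemma sgalg_mulf_eq0 : GRing.integral_domain_axiom A.
Proof.
move=> f g fg0; apply/orP; apply: contrapT => /not_orP[f0 g0].
by apply: (@sgalg_mulf_neq0 f g) fg0 => /eqP.
Qed.

HB.instance Definition _ := GRing.ComNzRing_hasMulInverse.Build A
  (@classical_mulVx A) (@classical_unitP A) (@classical_inv_out A).
HB.instance Definition _ := GRing.ComUnitRing_isIntegral.Build A sgalg_mulf_eq0.

End SemigroupAlgebraDomain.

Section DivisorialIdeals.
Variable R : idomainType.
Notation F := {fraction R}.
Notation "x %:F" := (@tofrac R x).
Implicit Types D E : set F.

Definition fractional_ideal D : Prop :=
  [/\ forall x y, D x -> D y -> D (x + y),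
      forall (r : R) x, D x -> D (r%:F * x),
      exists2 x, D x & x != 0 &
      exists2 d : R, d != 0 & forall x, D x -> range (@tofrac R) (d%:F * x)].

(* (R : D), which represents Hom_R(D, R) for a fractional ideal D. *)
Definition inverse_ideal D : set F :=
  [set x | forall y, D y -> range (@tofrac R) (x * y)].

Definition divisorial D : Prop :=
  fractional_ideal D /\ inverse_ideal (inverse_ideal D) = D.

Definition divisorial_ideal : Type := {D : set F | D \in [set D | divisorial D]}.

HB.instance Definition _ := SubChoice.on divisorial_ideal.

Definition module_iso D E : Prop := exists f : F -> F,
  [/\ set_bij D E f,
      forall x y, D x -> D y -> f (x + y) = f x + f y &
      forall (r : R) x, D x -> f (r%:F * x) = r%:F * f x].

Lemma module_iso_refl D : module_iso D D.
Proof. by exists id; split=> //; split=> // y Dy; exists y. Qed.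

Lemma module_iso_trans D1 D2 D3 :
  module_iso D1 D2 -> module_iso D2 D3 -> module_iso D1 D3.
Proof.
move=> [f [[f12 finj fsurj] fD fZ]] [g [[g23 ginj gsurj] gD gZ]].
exists (g \o f); split.
- split=> [x /f12/g23 //|x y|z /gsurj[y /fsurj[x D1x <-] <-]]; last by exists x.
  move=> /set_mem D1x /set_mem D1y /ginj fxy.
  by apply: finj; rewrite ?inE //; apply: fxy; rewrite inE; apply: f12.
- by move=> x y Dx Dy /=; rewrite fD // gD //; apply: f12.
- by move=> r x Dx /=; rewrite fZ // gZ //; apply: f12.
Qed.

Lemma module_iso_sym D E :
  fractional_ideal D -> module_iso D E -> module_iso E D.
Proof.
move=> [DD DZ _ _] [f [[fDE finj fsurj] fD fZ]].
have /choice[g gP] : forall y, exists x, E y -> D x /\ f x = y.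
  move=> y; have [/fsurj[x Dx <-]|nEy] := pselect (E y); first by exists x.
  by exists 0.
have fK x y : D x -> D y -> f x = f y -> x = y.
  by move=> Dx Dy; apply: finj; rewrite inE.
exists g; split.
- split=> [y Ey|y z /set_mem Ey /set_mem Ez gyz|x Dx]; first exact: (gP _ Ey).1.
    by rewrite -(gP _ Ey).2 -(gP _ Ez).2 gyz.
  have Ef := fDE _ Dx; exists (f x) => //.
  by apply: fK => //; [exact: (gP _ Ef).1|exact: (gP _ Ef).2].
- move=> y z Ey Ez; have [Dy fy] := gP _ Ey; have [Dz fz] := gP _ Ez.
  have Eyz : E (y + z) by rewrite -fy -fz -fD //; apply/fDE/DD.
  by apply: fK; [exact: (gP _ Eyz).1|exact: DD|rewrite (gP _ Eyz).2 fD // fy fz].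
- move=> r y Ey; have [Dy fy] := gP _ Ey.
  have Ery : E (r%:F * y) by rewrite -fy -fZ //; apply/fDE/DZ.
  by apply: fK; [exact: (gP _ Ery).1|exact: DZ|rewrite (gP _ Ery).2 fZ // fy].
Qed.

Definition isob (D E : divisorial_ideal) : bool := `[< module_iso (val D) (val E) >].

Lemma isob_refl : reflexive isob.
Proof. by move=> D; apply/asboolP/module_iso_refl. Qed.

Lemma isob_sym : symmetric isob.
Proof.
have fr (D : divisorial_ideal) : fractional_ideal (val D).
  by have /set_mem[] := valP D.
by move=> D E; apply/asboolP/asboolP; apply: module_iso_sym.
Qed.

Lemma isob_trans : transitive isob.
Proof.
by move=> E D G /asboolP DE /asboolP EG; apply/asboolP/(module_iso_trans DE EG).
Qed.

Canonical isob_equiv := EquivRel isob isob_refl isob_sym isob_trans.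

(* Only the underlying set of the divisor class group is needed; its group
   law is ([D], [E]) |-> [(R : (R : DE))]. *)
Definition divisor_class : Type := {eq_quot isob_equiv}%qT.

Definition class_of (D : divisorial_ideal) : divisor_class :=
  (\pi_{eq_quot isob_equiv} D)%qT.

Definition generates (s : seq F) D : Prop :=
  D = [set x | exists r : 'I_(size s) -> R, x = \sum_(i < size s) (r i)%:F * s`_i].

(* The relation mu(D) = k. *)
Definition mu_is D (k : nat) : Prop :=
  (exists2 s : seq F, size s = k & generates s D) /\
  (forall s : seq F, generates s D -> (k <= size s)%N).

End DivisorialIdeals.

(* Main.v *)
Require Import Defs.
From HB Require Import structures.
From mathcomp Require Import all_boot all_order all_algebra.
From mathcomp Require Import generic_quotient fraction.
From mathcomp Require Import finmap.
From mathcomp Require Import boolp classical_sets functions cardinality.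
From mathcomp Require Import ring zify.
From mathcomp Require Import monalg.

(* A torus has trivial class group: K[gp(S)] is a localization of a
   polynomial ring, hence factorial. So a divisorial ideal D of R = K[S] may be
   multiplied by an element of Frac R in such a way that the elements
   multiplying D into K[gp(S)] are exactly those of K[gp(S)]. By normality, S
   is cut out of gp(S) by linear forms sigma_i >= 0. As the minimum of sigma_i
   on the support of a Laurent polynomial is additive on products, D = (R : (R
   : D)) is then spanned by the monomials with exponent in C = {u in gp(S) :
   sigma_i(u) >= b_i for all i}, and mu(D) bounds the number of minimal
   elements of C modulo S. Going down maximally along each generator of S in
   turn is a Lipschitz retraction of C onto its minimal elements, with a
   constant independent of b. Any two minimal elements are joined in C by a
   path whose steps are generators of S or their opposites; its retraction is a
   chain of minimal elements with bounded steps. Hence if mu(D) <= m then, up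
   to translation, the minimal elements of C lie in a ball depending only on m,
   and they determine C. *)

Set Implicit Arguments.
Unset Strict Implicit.
Unset Printing Implicit Defensive.

Import Order.TTheory GRing.Theory Num.Theory.

Local Open Scope classical_set_scope.
Local Open Scope ring_scope.

(** * Polynomials over a factorial domain *)

Definition divides (R : idomainType) (a b : R) : Prop := exists c, b = a * c.

(* Units count as primes, so that no unit factor has to be carried along in
   prime factorizations. *)
Definition prime_elt (R : idomainType) (p : R) : Prop :=
  p != 0 /\ forall a b, divides p (a * b) -> divides p a \/ divides p b.

Definition factorial_domain (R : idomainType) : Prop := forall x : R, x != 0 ->
  exists2 s : seq R, {in s, forall p, prime_elt p} & x = \prod_(p <- s) p.

Lemma divides_mulr (R : idomainType) (p a b : R) : divides p a -> divides p (a * b).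
Proof. by move=> [c ->]; exists (c * b); rewrite mulrA. Qed.

Lemma divides_mull (R : idomainType) (p a b : R) : divides p b -> divides p (a * b).
Proof. by rewrite mulrC; apply: divides_mulr. Qed.

Section Factorial.
Variable A : idomainType.
Implicit Types (a b c p q x y : A) (s : seq A) (f g h : {poly A}).

Lemma prime_elt_prod p s : prime_elt p -> divides p (\prod_(q <- s) q) ->
  p \is a GRing.unit \/ exists2 q, q \in s & divides p q.
Proof.
move=> [p0 pP]; elim: s => [|q s IH].
  rewrite big_nil => -[c /esym pc]; left; apply/unitrP; exists c.
  by rewrite mulrC pc.
rewrite big_cons => /pP[pq|/IH[]]; [by right; exists q; rewrite ?inE ?eqxx|by left|].
by move=> [r rs pr]; right; exists r; rewrite // inE rs orbT.
Qed.

Lemma dividesC a f : divides a%:P f <-> forall i, divides a f`_i.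
Proof.
split=> [[g ->] i|h]; first by exists g`_i; rewrite coefCM.
have [c hc] := choice h.
exists (\poly_(i < size f) c i); apply/polyP => i.
rewrite coefCM coef_poly; case: ltnP => [//|fi].
by rewrite mulr0 nth_default.
Qed.

Lemma divides_sum (I : Type) (r : seq I) (P : pred I) (F : I -> A) a :
  (forall i, P i -> divides a (F i)) -> divides a (\sum_(i <- r | P i) F i).
Proof.
move=> aF; elim/big_ind: _ => //; first by exists 0; rewrite mulr0.
by move=> x y [c ->] [d ->]; exists (c + d); rewrite mulrDr.
Qed.

Lemma divides_sub a x y : divides a (x + y) -> divides a y -> divides a x.
Proof. by move=> [c xy] [d yd]; exists (c - d); rewrite mulrBr -xy -yd addrK. Qed.

(* Compare the lowest coefficients of the two factors that p does not divide. *)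
Lemma prime_eltC p : prime_elt p -> prime_elt p%:P.
Proof.
move=> [p0 pP]; split; first by rewrite polyC_eq0.
move=> f g /dividesC pfg; apply: contrapT => /not_orP[].
have least h : ~ divides p%:P h ->
    exists2 i, ~ divides p h`_i & forall j, (j < i)%N -> divides p h`_j.
  rewrite dividesC -existsNE => -[i0 hi0].
  have ex : exists i, `[< ~ divides p h`_i >] by exists i0; apply/asboolP.
  exists (ex_minn ex); case: ex_minnP => i /asboolP // _ hi j ji.
  apply: contrapT => nj; have := hi j; rewrite leqNgt ji => /(_ _)/negP.
  by apply=> //; apply/asboolP.
move=> /least[i ni hi] /least[j nj hj].
have := pfg (i + j)%N.
rewrite coefM (bigD1 (inord i)) //= inordK ?ltnS ?leq_addr // addKn.
move=> pij; suff: divides p (f`_i * g`_j) by move=> /pP[/ni|/nj].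
apply: (divides_sub pij); apply: divides_sum => k ki.
have {}ki : (k : nat) != i.
  by apply: contraNneq ki => ki; apply/eqP/val_inj; rewrite /= inordK ?ltnS ?leq_addr.
case: (ltngtP k i) ki => // ki _; first by apply/divides_mulr/hi.
apply/divides_mull/hj.
by have := ltn_ord k; lia.
Qed.

(** Each prime of [s] stays prime in A[X], so it cancels from [g] or from [h]; [c] and [d] collect
    the primes cancelled on each side. *)
Lemma cancel_primes s f g h : {in s, forall p, prime_elt p} ->
  (\prod_(p <- s) p)%:P * f = g * h ->
  exists c d g' h', [/\ g = c%:P * g', h = d%:P * h' & f = g' * h'].
Proof.
elim: s f g h => [|p s IH] f g h sP.
  rewrite big_nil mul1r => ->; exists 1, 1, g, h.
  by rewrite !mul1r.
have pp : prime_elt p by apply: sP; rewrite inE eqxx.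
have sP' : {in s, forall p, prime_elt p}.
  by move=> q qs; apply: sP; rewrite inE qs orbT.
have pP0 : p%:P != 0 by rewrite polyC_eq0; case: pp.
rewrite big_cons polyCM -mulrA => pf.
have [] : divides p%:P g \/ divides p%:P h.
- by apply: (prime_eltC pp).2; rewrite -pf; apply: divides_mulr; exists 1; rewrite mulr1.
- move=> [g1 g1E]; move: pf; rewrite g1E -mulrA => /(mulfI pP0) /(IH _ _ _ sP').
  move=> [c [d [g' [h' [-> -> ->]]]]]; exists (p * c), d, g', h'.
  by rewrite polyCM mulrA.
- move=> [h1 h1E]; move: pf; rewrite h1E [g * _]mulrCA => /(mulfI pP0) /(IH _ _ _ sP').
  move=> [c [d [g' [h' [-> -> ->]]]]]; exists c, (p * d), g', h'.
  by rewrite polyCM mulrA.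
Qed.

Definition primitive_poly f := forall c, divides c%:P f -> c \is a GRing.unit.

Hypothesis AP : factorial_domain A.

(** Induction on the number of primes in a factorization of the leading coefficient: a nonunit one
    that divides [f] is split off. *)
Lemma primitive_part f : f != 0 -> exists2 c, c != 0 &
  exists2 g, f = c%:P * g & primitive_poly g.
Proof.
move=> f0; have /AP[s sP fs] : lead_coef f != 0 by rewrite lead_coef_eq0.
have [k sk] := ubnP (size s).
elim: k => // k IH in s f f0 sP fs sk *.
have [[p [ps pU [g fg]]]|nos] := pselect (exists p, [/\ p \in s,
    p \isn't a GRing.unit & divides p%:P f]).
- have p0 : p != 0 by have [] := sP _ ps.
  have [||||] := IH (rem p s) g.
  + by apply: contraNneq f0 => g0; rewrite fg g0 mulr0.
  + by move=> q /mem_rem /sP.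
  + apply: (mulfI p0); rewrite -[p in LHS]lead_coefC -lead_coefM -fg fs.
    by rewrite (big_rem p).
  + by rewrite size_rem //; case: (s) ps sk.
  move=> c c0 [h gh hP]; exists (p * c); first by rewrite mulf_neq0.
  by exists h => //; rewrite polyCM -mulrA -gh.
(* A nonunit prime factor [q] of [c] divides the leading coefficient, hence some [p] in [s], say
   [p = q * e]. If [p] divides [q], it divides [f], which is excluded; if it divides [e], then [q]
   is a unit. *)
exists 1; rewrite ?oner_eq0 //; exists f; rewrite ?mul1r // => c cf.
have c0 : c != 0.
  by apply: contraNneq f0 => c0; case: cf => g ->; rewrite c0 mul0r.
have [t tP ct] := AP c0.
rewrite ct big_seq; apply: rpred_prod => q qt; apply: contrapT => /negP qU.
have qc : divides q c by rewrite ct (big_rem q) //=; eexists.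
have qf : divides q (lead_coef f).
  move/dividesC: cf => /(_ (size f).-1)[d]; rewrite /lead_coef => ->.
  exact: divides_mulr.
have [/(negP qU) []|[p ps [e pe]]] : q \is a GRing.unit \/ exists2 p, p \in s & divides q p.
  by apply: prime_elt_prod; rewrite -?fs //; apply: tP.
have [p0 pP] := sP _ ps.
have pU : p \isn't a GRing.unit by apply: contraNN qU; rewrite pe unitrM => /andP[].
have /pP[[d qd]|[d ed]] : divides p (q * e) by exists 1; rewrite mulr1.
  case: nos; exists p; split=> //; case: (cf) => g ->.
  apply: divides_mulr; exists (d * \prod_(y <- rem q t) y)%:P.
  by rewrite -polyCM mulrA -qd ct (big_rem q).
case/negP: qU; apply/unitrP; exists d.
have /(mulfI p0) e1 : p * (q * d) = p * 1 by rewrite mulr1 [RHS]pe ed; ring.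
by split; rewrite // mulrC.
Qed.

Lemma size_poly1_const f : f != 0 -> (size f <= 1)%N -> exists2 c, c != 0 & f = c%:P.
Proof.
by move=> f0 /size1_polyC fC; exists f`_0 => //; rewrite -polyC_eq0 -fC.
Qed.

(** Gauss's lemma: the primes of [c] are distributed over the two factors, and those that fall to
    the primitive [f] have a unit as product. *)
Lemma divides_primitive c f g : c != 0 -> primitive_poly f ->
  divides f (c%:P * g) -> divides f g.
Proof.
move=> /AP[s sP ->] fP [w /(cancel_primes sP) [c1 [c2 [f' [w' [ff' _ ->]]]]]].
have /unitrP[d [_ dc]] : c1 \is a GRing.unit by apply: fP; exists f'.
by exists (d%:P * w'); rewrite ff' mulrACA -polyCM dc mul1r.
Qed.

(* A nonzero combination r of f and g of minimal degree divides both of them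
   up to constants; as f is irreducible, r is a constant or f itself, again up
   to constants. *)
Lemma prime_elt_irreducible f : f != 0 -> primitive_poly f ->
  (forall g h, f = g * h -> (size g <= 1)%N \/ (size h <= 1)%N) -> prime_elt f.
Proof.
move=> f0 fP firr; split=> // g h fgh.
pose I (r : {poly A}) := r != 0 /\ exists u v : {poly A}, r = u * f + v * g.
have [r [[r0 [u [v rE]]] rmin]] :
    exists r, I r /\ forall r', I r' -> (size r <= size r')%N.
  have ex : exists k, `[< exists2 r, I r & size r = k >].
    exists (size f); apply/asboolP; exists f => //.
    by split=> //; exists 1, 0; rewrite mul1r mul0r addr0.
  case: (ex_minnP ex) => k /asboolP[r Ir rk] kmin.
  by exists r; split=> // r' Ir'; rewrite rk; apply: kmin; apply/asboolP; exists r'.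
have mod0 (a u1 v1 : {poly A}) : a %% r = u1 * f + v1 * g -> a %% r = 0.
  move=> aE; apply: contrapT => /eqP a0.
  have : I (a %% r) by split=> //; exists u1, v1.
  by move=> /rmin; rewrite leqNgt Pdiv.Idomain.ltn_modpN0.
have lr k : lead_coef r ^+ k != 0 by rewrite expf_neq0 // lead_coef_eq0.
have modE (a : {poly A}) : a %% r = (lead_coef r ^+ scalp a r)%:P * a - (a %/ r) * r.
  by rewrite mul_polyC Pdiv.Idomain.divp_eq addrC addKr.
have rf : (lead_coef r ^+ scalp f r)%:P * f = (f %/ r) * r.
  apply/eqP; rewrite -subr_eq0 -modE; apply/eqP.
  apply: (mod0 _ ((lead_coef r ^+ scalp f r)%:P - (f %/ r) * u) (- (f %/ r * v))).
  by rewrite modE rE; ring.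
have rg : (lead_coef r ^+ scalp g r)%:P * g = (g %/ r) * r.
  apply/eqP; rewrite -subr_eq0 -modE; apply/eqP.
  apply: (mod0 _ (- (g %/ r * u)) ((lead_coef r ^+ scalp g r)%:P - (g %/ r) * v)).
  by rewrite modE rE; ring.
have [s sP sE] := AP (lr (scalp f r)).
rewrite sE in rf; have [c [d [q' [r' [qE r'E fE]]]]] := cancel_primes sP rf.
have [q0 r'0] : q' != 0 /\ r' != 0 by apply/andP; rewrite -negb_or -mulf_eq0 -fE.
have d0 : d != 0.
  by apply: contraNneq r0 => d0; rewrite r'E d0 mul0r.
(* If [q'] is constant, it is a unit since [f] is primitive, so [f] divides [r], and then [g] by
   Gauss's lemma. If [r'] is constant, the ideal of [f] and [g] contains the nonzero constant
   [d * e], and [f] divides the product of this constant with [h]. *)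
have [/(size_poly1_const q0) [e e0 qe]|/(size_poly1_const r'0) [e e0 re]] := firr _ _ fE.
- have /unitrP[e' [_ ee']] : e \is a GRing.unit.
    by apply: fP; exists r'; rewrite -qe.
  left; apply: (divides_primitive (lr (scalp g r)) fP); rewrite rg r'E.
  exists (g %/ r * d%:P * e'%:P); rewrite fE qe.
  have -> : e%:P * r' * (g %/ r * d%:P * e'%:P) = g %/ r * (d%:P * r') * (e * e')%:P.
    by rewrite polyCM; ring.
  by rewrite ee' polyC1 mulr1 -r'E.
- right; apply: (@divides_primitive (d * e) f h _ fP); first by rewrite mulf_neq0.
  case: fgh => w gh; exists (u * h + v * w).
  by rewrite polyCM -re -r'E rE mulrDr mulrDl mulrCA -[v * g * h]mulrA gh; ring.
Qed.

(** Induction on the size: the content factors in [A]; the primitive part is either a product of two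
    nonconstant polynomials of smaller size or irreducible, hence prime. *)
Lemma factorial_poly : factorial_domain {poly A}.
Proof.
move=> f; have [k fk] := ubnP (size f).
elim: k => // k IH in f fk * => f0.
have [c c0 [g fE gP]] := primitive_part f0.
have [s sP cE] := AP c0.
have g0 : g != 0 by apply: contraNneq f0 => g0; rewrite fE g0 mulr0.
have [t tP gE] : exists2 t : seq {poly A},
    {in t, forall p : {poly A}, prime_elt p} & g = \prod_(p <- t) p.
  have [[a [b [gab [a1 b1]]]]|girr] := pselect (exists a b : {poly A},
      g = a * b /\ ~~ (size a <= 1)%N /\ ~~ (size b <= 1)%N).
    have [a0 b0] : a != 0 /\ b != 0.
      by split; [apply: contraNneq a1|apply: contraNneq b1] => ->; rewrite size_poly0.
    have sz : (size f = size a + size b - 1)%N.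
      by rewrite fE mul_polyC size_scale // gab size_mul // subn1.
    have [||t1 t1P aE] := IH a; [by move: b1 fk; rewrite sz; lia|by []|].
    have [||t2 t2P bE] := IH b; [by move: a1 fk; rewrite sz; lia|by []|].
    exists (t1 ++ t2); last by rewrite big_cat /= -aE -bE.
    by move=> p; rewrite mem_cat => /orP[/t1P|/t2P].
  exists [:: g]; last by rewrite big_seq1.
  move=> p; rewrite inE => /eqP ->; apply: prime_elt_irreducible => // a b gab.
  apply: contrapT => /not_orP[/negP a1 /negP b1]; apply: girr.
  by exists a, b.
exists ([seq p%:P | p <- s] ++ t).
  by move=> p; rewrite mem_cat => /orP[/mapP[q /sP qP ->]|/tP //]; apply: prime_eltC.
by rewrite big_cat /= big_map -gE -rmorph_prod -cE.
Qed.
End Factorial.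

Lemma factorial_field (K : fieldType) : factorial_domain K.
Proof.
move=> x x0; exists [:: x]; last by rewrite big_seq1.
move=> p; rewrite inE => /eqP ->; split=> // a b _; left.
by exists (x^-1 * a); rewrite mulVKf.
Qed.

(** * Greatest common divisors of sets *)

Section GcdInField.
Variables (F : fieldType) (L : set F).
Hypotheses (L1 : L 1) (LM : forall x y, L x -> L y -> L (x * y)).

(** Divisibility within [L] is read off quotients in the ambient field; [L] will be the ring of
    Laurent polynomials inside Frac R. *)
Definition prime_in (p : F) : Prop := [/\ L p, p != 0 &
  forall a b, L a -> L b -> L (a * b / p) -> L (a / p) \/ L (b / p)].

(** The gcd [f] is described by its multipliers into [L]. Induction on the prime factorization of
    one element of [D]: a prime that divides all of [D] is divided out, and if there is none the gcd
    is 1. *)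
Lemma gcd_exists (s : seq F) (D : set F) : {in s, forall p, prime_in p} ->
  (forall g, D g -> L g) -> D (\prod_(p <- s) p) ->
  exists2 f, f != 0 & forall x, (forall g, D g -> L (x * g)) <-> L (x * f).
Proof.
have [k sk] := ubnP (size s).
elim: k => // k IH in s D sk * => sP DL Ds.
have [[p [ps pD]]|nop] := pselect (exists p, p \in s /\ forall g, D g -> L (g / p)).
  have [_ p0 _] := sP _ ps.
  have [||_ [g Dg <-]||f f0 fP] := IH (rem p s) [set g / p | g in D]%classic.
  - by rewrite size_rem //; case: (s) ps sk.
  - by move=> q /mem_rem /sP.
  - exact: pD.
  - by exists (\prod_(q <- s) q) => //; rewrite (big_rem p) //= mulrC mulKf.
  exists (p * f); rewrite ?mulf_neq0 // => x; rewrite mulrA -fP; split.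
    by move=> h _ [g Dg <-]; rewrite mulrA mulrAC mulfK //; apply: h.
  move=> h g Dg; have -> : x * g = x * p * (g / p).
    by rewrite mulrA mulrAC mulfK.
  by apply: h; exists g.
exists 1; rewrite ?oner_eq0 // => x; rewrite mulr1; split=> [h|Lx g /DL]; last exact: LM.
have {sk} xs : L (x * \prod_(p <- s) p) by apply: h.
have ss : {subset s <= s} by [].
(* The primes are peeled off the product one at a time: some [g] in [D] is not divisible by [p], but
   its product with [x * (p * ...)] is, so [p] cancels from the latter. *)
elim: {1 3}s ss xs => [_|p t IHt ts]; first by rewrite big_nil mulr1.
have ps : p \in s by apply: ts; rewrite inE eqxx.
have ts' : {subset t <= s} by move=> q qt; apply: ts; rewrite inE qt orbT.
rewrite big_cons => Lt; apply: IHt => //.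
have Lpt : L (\prod_(q <- t) q).
  rewrite big_seq; apply: (big_ind L) => // q /ts' /sP[]; exact.
have [Lp p0 pP] := sP _ ps.
have [g [Dg gp]] : exists g, D g /\ ~ L (g / p).
  apply: contrapT => hn; apply: nop; exists p; split=> // g Dg.
  by apply: contrapT => gp; apply: hn; exists g.
have [] := pP _ _ Lt (DL _ Dg).
- have -> : x * (p * \prod_(q <- t) q) * g / p = (x * g) * \prod_(q <- t) q by field.
  by apply: LM => //; apply: h.
- by rewrite mulrCA mulrAC mulfV // mul1r.
- by [].
Qed.

End GcdInField.

(** * Rational cones *)

Lemma seq_max (T : eqType) d (R : orderType d) (s : seq T) (key : T -> R) : s <> [::] ->
  exists2 v, v \in s & {in s, forall w, (key w <= key v)%O}.
Proof.
elim: s => // x s IH _; case: (s =P [::]) => [->|/IH[v vs vmax]].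
  by exists x; rewrite ?inE // => w; rewrite inE => /eqP ->.
have [xv|vx] := leP (key x) (key v).
  by exists v => [|w]; rewrite inE ?vs ?orbT // => /orP[/eqP ->|/vmax].
exists x => [|w]; rewrite inE ?eqxx // => /orP[/eqP -> //|/vmax wv].
exact: le_trans wv (ltW vx).
Qed.

Section Cones.
Variable n : nat.
Implicit Types (x y g : 'rV[int]_n) (v w : 'cV[int]_n).

Definition pairing w x : int := (x *m w) 0 0.

Lemma pairing_is_additive w : additive (pairing w).
Proof. by move=> x y; rewrite /pairing mulmxBl !mxE. Qed.

HB.instance Definition _ w :=
  GRing.isAdditive.Build 'rV[int]_n int (pairing w) (pairing_is_additive w).

Lemma pairing_comb (a b : int) v w x :
  pairing (a *: v - b *: w) x = a * pairing v x - b * pairing w x.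
Proof. by rewrite /pairing mulmxBr -!scalemxAr !mxE. Qed.

Lemma pairing_sub w x y (N k : nat) :
  pairing w (x *+ N - y *+ k) = pairing w x * N%:Z - pairing w y * k%:Z.
Proof. by rewrite raddfB !raddfMn /= !pmulrn !mulrzz mulNr. Qed.

Lemma pairing_delta i x : pairing (delta_mx i 0) x = x 0 i.
Proof.
rewrite /pairing mxE (bigD1 i) //= mxE !eqxx mulr1 big1 ?addr0 // => j ji.
by rewrite mxE (negPf ji) mulr0.
Qed.

(** The rational cone spanned by [G], with denominators cleared one generator at a time by the
    factor [N]. *)
Fixpoint cone (G : seq 'rV[int]_n) x : Prop :=
  if G is g :: G' then exists N k : nat, (0 < N)%N /\ cone G' (x *+ N - g *+ k)
  else x = 0.

Lemma cone0 G : cone G 0.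
Proof. by elim: G => //= g G IH; exists 1%N, 0%N; rewrite subr0. Qed.

Lemma cone_mem G g : g \in G -> cone G g.
Proof.
elim: G => //= h G IH; rewrite inE => /orP[/eqP ->|/IH gG].
  by exists 1%N, 1%N; rewrite subrr; split=> //; apply: cone0.
by exists 1%N, 0%N; rewrite subr0.
Qed.

(* Fourier-Motzkin elimination of the coefficient of the last generator. *)
Lemma cone_forms G : exists W : seq 'cV[int]_n,
  forall x, {in W, forall w, 0 <= pairing w x} <-> cone G x.
Proof.
elim: G => [|g G [W WP]] /=.
  (* The zero cone is cut out by the coordinate forms and their opposites. *)
  exists ([seq delta_mx i 0 | i : 'I_n] ++ [seq - delta_mx i 0 | i : 'I_n]) => x.
  split=> [h|-> w _]; last by rewrite raddf0.
  apply/rowP => i; rewrite mxE; apply/eqP; rewrite eq_le -oppr_ge0; apply/andP; split.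
    have := h (- delta_mx i 0); rewrite /pairing mulmxN mxE -/(pairing _ _) pairing_delta.
    by apply; rewrite mem_cat orbC; apply/orP; left; apply/codomP; exists i.
  rewrite -pairing_delta; apply: h.
  by rewrite mem_cat; apply/orP; left; apply/codomP; exists i.
pose Wneg := [seq v <- W | pairing v g < 0].
(* Kept are the forms that are nonnegative at [g] and, for each pair of forms of opposite signs at
   [g], their positive combination vanishing at [g]. *)
exists ([seq w <- W | 0 <= pairing w g] ++
  [seq pairing w g *: v - pairing v g *: w | w <- [seq w <- W | 0 < pairing w g],
                                             v <- Wneg]) => x; split.
- move=> h.
  have hpos w : w \in W -> 0 <= pairing w g -> 0 <= pairing w x.
    by move=> wW wg; apply: h; rewrite mem_cat mem_filter wg wW.
  have hmix w v : w \in W -> v \in W -> 0 < pairing w g -> pairing v g < 0 ->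
      0 <= pairing w g * pairing v x - pairing v g * pairing w x.
    move=> wW vW wg vg; rewrite -pairing_comb; apply: h.
    rewrite mem_cat; apply/orP; right; apply/allpairsP; exists (w, v).
    by rewrite !mem_filter wg wW vg vW.
  have [[v0 v0W v0x]|nov] := pselect (exists2 v, v \in Wneg & pairing v x < 0); last first.
    exists 1%N, 0%N; split=> //; rewrite subr0; apply/WP => w wW.
    have [/hpos -> //|wg] := leP 0 (pairing w g).
    rewrite leNgt; apply/negP => wx; apply: nov; exists w => //.
    by rewrite mem_filter wg.
  (* The largest ratio v(x) / v(g) is the least lambda for which all forms of [Wneg] are nonnegative
     at x - lambda g; it is positive because of [v0]. *)
  have [|v] := @seq_max _ _ rat Wneg (fun v => (pairing v x)%:~R / (pairing v g)%:~R).
    by move=> W0; rewrite W0 in v0W.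
  rewrite mem_filter => /andP[vg vW] vmax.
  have vmaxE w : w \in Wneg -> pairing w x * pairing v g <= pairing v x * pairing w g.
    move=> wN; have := vmax _ wN; move: wN; rewrite mem_filter => /andP[wg _].
    by rewrite ler_ndivrMr ?ltrz0 // mulrAC ler_ndivrMr ?ltrz0 // -!intrM ler_int.
  have vx : pairing v x < 0.
    have := vmaxE _ v0W; move: v0W; rewrite mem_filter => /andP[v0g _].
    move=> /(lt_le_trans _) -/(_ 0); rewrite nmulr_rgt0 // nmulr_lgt0 //.
    exact.
  exists `|pairing v g|%N, `|pairing v x|%N; split; first by rewrite absz_gt0 lt_eqF.
  apply/WP => w wW; rewrite pairing_sub.
  have -> : `|pairing v g|%N = - pairing v g :> int by lia.
  have -> : `|pairing v x|%N = - pairing v x :> int by lia.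
  have [wg|wg|wg] := ltgtP (pairing w g) 0.
  + have /vmaxE : w \in Wneg by rewrite mem_filter wg.
    by move=> ?; lia.
  + by have := hmix _ _ wW vW wg vg; lia.
  + by have := hpos _ wW; rewrite wg lexx => /(_ isT) wx;
      rewrite mul0r subr0 mulr_ge0 // oppr_ge0 ltW.
- move=> [N [k [N0 /WP h]]] w; rewrite mem_cat => /orP[|].
    rewrite mem_filter => /andP[wg /h]; rewrite pairing_sub subr_ge0.
    have /le_trans wk : 0 <= pairing w g * k by apply: mulr_ge0.
    by move=> /wk; rewrite pmulr_lge0.
  move=> /allpairsP[[w1 v1] /= []]; rewrite !mem_filter.
  move=> /andP[wg /h hw] /andP[vg /h hv] ->; rewrite pairing_comb.
  move: hw hv; rewrite !pairing_sub.
  move: (pairing w1 _) (pairing w1 _) (pairing v1 _) (pairing v1 _) wg vg => a b c d.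
  move=> b0 d0 ab cd.
  have : 0 <= b * (c * N - d * k) - d * (a * N - b * k).
    by apply: addr_ge0; [apply: mulr_ge0; lia|rewrite -mulNr; apply: mulr_ge0; lia].
  have -> : b * (c * N - d * k) - d * (a * N - b * k) = (b * c - d * a) * N by ring.
  by rewrite pmulr_lge0.
Qed.

End Cones.

(** * Bases of lattices *)

Fixpoint int_span (V : zmodType) (bs : seq V) (w : V) : Prop :=
  if bs is b :: bs' then exists z : int, int_span bs' (w - b *~ z) else w = 0.

Fixpoint int_free (V : zmodType) (bs : seq V) : Prop :=
  if bs is b :: bs' then
    (forall z : int, int_span bs' (b *~ z) -> z = 0) /\ int_free bs'
  else True.

Section LatticeBasis.
Variable n : nat.
Implicit Type G : set 'rV[int]_n.

Lemma subgroupMz G x (z : int) : G 0 -> (forall x y, G x -> G y -> G (x - y)) ->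
  G x -> G (x *~ z).
Proof.
move=> G0 GB Gx.
have Gn (k : nat) : G (x *+ k).
  elim: k => [|k IH]; first by rewrite mulr0n.
  have -> : x *+ k.+1 = x *+ k - (0 - x) by rewrite sub0r opprK mulrSr.
  by apply: (GB) => //; apply: GB.
case: z => k; first by rewrite -pmulrn.
by rewrite NegzE mulrNz -pmulrn -sub0r; apply: GB.
Qed.

Lemma int_span_ind (V : zmodType) (bs : seq V) (P : V -> Prop) w :
  P 0 -> (forall b (z : int) x, b \in bs -> P x -> P (b *~ z + x)) ->
  int_span bs w -> P w.
Proof.
move=> P0; elim: bs w => [|b bs IH] w PS /=; first by move=> ->.
move=> [z /IH]; rewrite -{2}[w](subrKC (b *~ z)) => h.
apply: (PS); first by rewrite inE eqxx.
by apply: h => c k x cb; apply: PS; rewrite inE cb orbT.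
Qed.

(* Descending along the flag of coordinate subspaces: a vector of G whose
   leading coordinate is minimal completes a basis of the smaller subgroup
   where this coordinate vanishes. *)
Lemma lattice_basis_flag (k : nat) G : G 0 ->
  (forall x y, G x -> G y -> G (x - y)) ->
  (forall x, G x -> forall i : 'I_n, (i + k < n)%N -> x 0 i = 0) ->
  exists bs : seq 'rV[int]_n,
    [/\ {in bs, forall b, G b}, int_free bs & forall x, G x -> int_span bs x].
Proof.
elim: k G => [|k IH] G G0 GB Gflag.
  exists [::]; split=> // x /Gflag x0; apply/rowP => i.
  by rewrite x0 ?mxE // addn0.
have [nk|kn] := leqP n k.
  by apply: IH => // x Gx i ik; have := leq_ltn_trans (leq_addl i k) ik; rewrite ltnNge nk.
have jn : (n - k.+1 < n)%N by lia.
pose j := Ordinal jn.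
have [Gj0|nG] := pselect (forall x, G x -> x 0 j = 0).
  apply: IH => // x Gx i ik.
  have [ik'|ik'] := ltnP (i + k.+1) n; first exact: Gflag.
  have -> : i = j by apply/val_inj => /=; lia.
  exact: Gj0.
have ex : exists a, `[< exists x, [/\ G x, x 0 j != 0 & absz (x 0 j) = a] >].
  apply: contrapT => h; apply: nG => x Gx; apply: contrapT => /eqP xj.
  by apply: h; exists (absz (x 0 j)); apply/asboolP; exists x.
case: (ex_minnP ex) => a /asboolP[b [Gb bj ba]] amin.
have bmin x : G x -> (absz (x ord0 j) < a)%N -> x 0 j = 0.
  move=> Gx xa; apply: contrapT => /eqP xj.
  have := amin (absz (x 0 j)); rewrite leqNgt xa => /(_ _)/negP; apply=> //.
  by apply/asboolP; exists x.
have GMz x (z : int) : G x -> G (x *~ z) by apply: subgroupMz.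
have [||x []|bs [bsG bsF bsS]] := IH [set x | G x /\ x 0 j = 0]%classic.
- by split=> //; rewrite mxE.
- by move=> x y [Gx xj] [Gy yj]; split; [apply: GB|rewrite !mxE xj yj subr0].
- move=> Gx xj i ik.
  have [ik'|ik'] := ltnP (i + k.+1) n; first exact: Gflag.
  by have -> : i = j by apply/val_inj => /=; lia.
have mulzE (x : 'rV[int]_n) (z : int) : (x *~ z) 0 j = z * x 0 j.
  by rewrite -scaler_int intz !mxE.
exists (b :: bs); split=> [c|/=|x Gx /=].
- by rewrite inE => /orP[/eqP ->|/bsG[]].
- split=> // z bz.
  have : (b *~ z) 0 j = 0.
    apply: (int_span_ind (P := fun w : 'rV[int]_n => w 0 j = 0) _ _ bz).
      by rewrite mxE.
    by move=> c y x /bsG[_ cj] xj; rewrite mxE mulzE cj xj mulr0.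
  by move/eqP; rewrite mulzE mulf_eq0 (negPf bj) orbF => /eqP.
(* Euclidean division leaves a leading coordinate smaller than the minimal one, hence zero. *)
- exists (x ord0 j %/ b ord0 j)%Z; apply: bsS.
  have xG : G (x - b *~ (x ord0 j %/ b ord0 j)%Z) by apply: GB => //; apply: GMz.
  split=> //; apply: bmin => //; rewrite !mxE.
  have -> : x 0 j + - (b *~ (x ord0 j %/ b ord0 j)%Z) 0 j = (x ord0 j %% b ord0 j)%Z.
    by rewrite mulzE {1}(divz_eq (x 0 j) (b 0 j)) addrAC subrr add0r.
  by have := ltz_mod (x 0 j) bj; have := modz_ge0 (x 0 j) bj; lia.
Qed.

Lemma lattice_basis G : G 0 -> (forall x y, G x -> G y -> G (x - y)) ->
  exists bs : seq 'rV[int]_n,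
    [/\ {in bs, forall b, G b}, int_free bs & forall x, G x -> int_span bs x].
Proof.
move=> G0 GB; apply: (lattice_basis_flag (k := n)) => // x _ i.
by rewrite ltnNge leq_addl.
Qed.

End LatticeBasis.

(** * Minimal elements of a convex set of exponents *)

Section Groups.
Variables (n : nat) (S : positiveAffineSemigroup n).
Implicit Types x y g : 'rV[int]_n.

Lemma pas_generators : exists2 gens : seq 'rV[int]_n,
  {in gens, forall g, pas_set S g} &
  forall P : 'rV[int]_n -> Prop, P 0 ->
    (forall g x, g \in gens -> pas_set S x -> P x -> P (g + x)) ->
    forall x, pas_set S x -> P x.
Proof.
have [s sE] := pas_affine S.
have sS : {in s, forall g, pas_set S g}.
  move=> g gs; rewrite sE /=.
  have gi : (index g s < size s)%N by rewrite index_mem.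
  exists (fun i => (i == Ordinal gi) : nat).
  rewrite (bigD1 (Ordinal gi)) //= eqxx mulr1n nth_index // big1 ?addr0 // => i.
  by move=> /negPf ->; rewrite mulr0n.
exists s => // P P0 PS x; rewrite {1}sE => -[c ->].
suff: pas_set S (\sum_(i < size s) s`_i *+ c i) /\ P (\sum_(i < size s) s`_i *+ c i).
  by case.
elim: (index_enum _) => [|i r [IHS IHP]]; first by rewrite big_nil; split=> //; apply: pas0.
rewrite big_cons; move: IHS IHP; set y := \sum_(j <- r) _ => Sy Py.
elim: (c i) => [|k [IHS IHP]]; first by rewrite mulr0n add0r.
have gs : s`_i \in s by apply: mem_nth.
by rewrite mulrS -addrA; split; [apply: pasD => //; apply: sS|apply: PS].
Qed.

Lemma gpS x : pas_set S x -> gp S x.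
Proof. by move=> Sx; exists x => //; exists 0; rewrite ?subr0 //; apply: pas0. Qed.

Lemma gp0 : gp S 0. Proof. exact/gpS/pas0. Qed.

Lemma gpD x y : gp S x -> gp S y -> gp S (x + y).
Proof.
move=> [a Sa [b Sb <-]] [c Sc [d Sd <-]].
exists (a + c); first exact: pasD.
by exists (b + d); [apply: pasD|rewrite addrACA opprD].
Qed.

Lemma gpN x : gp S x -> gp S (- x).
Proof. by move=> [a Sa [b Sb <-]]; exists b => //; exists a; rewrite // opprB. Qed.

Lemma gpB x y : gp S x -> gp S y -> gp S (x - y).
Proof. by move=> Gx Gy; apply: gpD => //; apply: gpN. Qed.

(** A point of the cone over the generators has a positive multiple in S; if it also lies in gp(S),
    normality puts the point itself in S. *)
Lemma normal_forms : normal_semigroup (pas_set S) ->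
  exists W : seq 'cV[int]_n, forall x,
    pas_set S x <-> gp S x /\ {in W, forall w, 0 <= pairing w x}.
Proof.
move=> hn; have [gens gensS gind] := pas_generators.
have [W WP] := cone_forms gens; exists W => x; split.
  move=> Sx; split; first exact: gpS.
  move=> w wW; move: x Sx; apply: gind; first by rewrite raddf0.
  move=> g x /cone_mem/WP/(_ _ wW) g0 _ x0.
  by rewrite raddfD addr_ge0.
move=> [Gx /WP].
suff: cone gens x -> exists2 N, (0 < N)%N & pas_set S (x *+ N).
  by move=> /[apply] -[N N0 SN]; apply: hn SN.
have : {in gens, forall g, pas_set S g} by [].
elim: gens x {Gx gensS gind WP} => [|g gens IH] x gensS /=.
  by move=> ->; exists 1%N => //; apply: pas0.
move=> [N [k [N0 /IH[|M M0 SM]]]].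
  by move=> h hg; apply: gensS; rewrite inE hg orbT.
exists (N * M)%N; first by rewrite muln_gt0 N0.
have -> : x *+ (N * M) = (x *+ N - g *+ k) *+ M + g *+ (k * M).
  by rewrite mulrnBl -!mulrnA subrK.
apply: pasD => //; elim: (k * M)%N => [|j IHj]; first by rewrite mulr0n; apply: pas0.
by rewrite mulrS; apply: pasD => //; apply: gensS; rewrite inE eqxx.
Qed.

End Groups.

Section MinimalElements.
Variables (n : nat) (S : positiveAffineSemigroup n).
Implicit Types (x y z u r g : 'rV[int]_n) (b : 'cV[int]_n -> int).
Variables (gens : seq 'rV[int]_n) (W : seq 'cV[int]_n).
Hypotheses (gensS : {in gens, forall g, pas_set S g})
  (gens_ind : forall P : 'rV[int]_n -> Prop, P 0 ->
    (forall g x, g \in gens -> pas_set S x -> P x -> P (g + x)) ->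
    forall x, pas_set S x -> P x)
  (WP : forall x, pas_set S x <-> gp S x /\ {in W, forall w, 0 <= pairing w x}).

Definition halfspaces b : set 'rV[int]_n :=
  [set u | gp S u /\ {in W, forall w, b w <= pairing w u}]%classic.

Definition minimal (C : set 'rV[int]_n) u : Prop :=
  C u /\ forall s, pas_set S s -> C (u - s) -> s = 0.

(** Distance is measured by the forms in [W], which separate the points of gp(S) because S is
    positive. *)
Definition near (B : nat) x y : Prop :=
  {in W, forall w, `|pairing w x - pairing w y| <= B%:Z}.

Lemma pas_pairing_ge0 x w : pas_set S x -> w \in W -> 0 <= pairing w x.
Proof. by move=> /WP[_ h] /h. Qed.

Lemma pas_pairing_eq0 x : gp S x -> {in W, forall w, pairing w x = 0} -> x = 0.
Proof.
move=> Gx x0; apply: (@pas_positive _ S).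
  by apply/WP; split=> // w /x0 ->.
exists (- x); last by rewrite subrr.
by apply/WP; split; [apply: gpN|move=> w /x0 x0w; rewrite raddfN /= x0w oppr0].
Qed.

Lemma halfspacesD b u s : halfspaces b u -> pas_set S s -> halfspaces b (u + s).
Proof.
move=> [Gu bu] Ss; split; first by apply: gpD => //; apply: gpS.
by move=> w wW; rewrite raddfD /= ler_wpDr ?bu // pas_pairing_ge0.
Qed.

(** * The retraction onto the minimal elements *)

Section Push.
Variable b : 'cV[int]_n -> int.
Let C := halfspaces b.

(** For [g] in S, going down by [g] never re-enters [C] after leaving it, so [r] is the lowest point
    of [C] on the way down from [z]. *)
Definition push g z r : Prop := exists2 k : nat, r = z - g *+ k & C r /\ ~ C (r - g).

Lemma push_exists g z : pas_set S g -> g != 0 -> C z -> exists r, push g z r.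
Proof.
move=> Sg g0 Cz.
have [w wW wg] : exists2 w, w \in W & 0 < pairing w g.
  apply: contrapT => h; move/eqP: g0; apply.
  apply: pas_pairing_eq0 => [|w wW]; first exact: gpS.
  apply/eqP; rewrite eq_le pas_pairing_ge0 // andbT leNgt.
  by apply/negP => wg; apply: h; exists w.
have ex : exists k, `[< ~ C (z - g *+ k.+1) >].
  (* Each step lowers [w] by at least 1, so one step more than this number brings it below [b w]. *)
  exists (absz (pairing w z - b w)); apply/asboolP => -[_ /(_ _ wW)].
  rewrite raddfB raddfMn /= pmulrn mulrzz => h.
  have : `|pairing w z - b w|%N.+1%:Z * 1 <= `|pairing w z - b w|%N.+1%:Z * pairing w g.
    by rewrite ler_wpM2l //; lia.
  lia.
case: (ex_minnP ex) => k /asboolP nC kmin.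
exists (z - g *+ k); exists k => //; split; last by rewrite -addrA -opprD -mulrSr.
case: k {nC} kmin => [|k] kmin; first by rewrite mulr0n subr0.
apply: contrapT => nC; have := kmin k; rewrite ltnn => h.
by have : false by apply: h; apply/asboolP.
Qed.

(* The number of steps of length g is a minimum over W of functions
   floor((w z - b w) / w g), each of which moves by at most the change of w z. *)
Lemma push_le (B : nat) g z1 z2 k1 k2 : gp S g ->
  near B z1 z2 -> C (z1 - g *+ k1) -> C (z2 - g *+ k2) -> ~ C (z2 - g *+ k2 - g) ->
  (k1 <= k2 + B)%N.
Proof.
move=> Gg z12 C1 [G2 C2] nC2.
have [w wW wlt] : exists2 w, w \in W & pairing w (z2 - g *+ k2 - g) < b w.
  apply: contrapT => h; apply: nC2; split; first exact: gpB.
  by move=> w wW; rewrite leNgt; apply/negP => ?; apply: h; exists w.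
have := C1.2 _ wW; have := C2 _ wW; have := z12 _ wW; move: wlt.
rewrite !raddfB !raddfMn /= !pmulrn !mulrzz.
move: (pairing w z1) (pairing w z2) (pairing w g) (b w) => p1 p2 q c.
move=> h1 h2 h3 h4; rewrite leqNgt; apply/negP => k12.
have q0 : 1 <= q by lia.
have : (k2%:Z + B%:Z + 1) * q <= k1%:Z * q by rewrite ler_wpM2r; lia.
have : B%:Z * 1 <= B%:Z * q by rewrite ler_wpM2l; lia.
by rewrite !mulrDl mul1r mulr1; lia.
Qed.

(** By [push_le] the numbers of steps differ by at most [B], and a step moves each form by at most
    [M]; this adds [B * M] to the initial distance [B]. *)
Lemma push_lipschitz (B M : nat) g z1 z2 r1 r2 : gp S g ->
  {in W, forall w, `|pairing w g| <= M%:Z} ->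
  near B z1 z2 -> push g z1 r1 -> push g z2 r2 -> near (B * M.+1) r1 r2.
Proof.
move=> Gg gM z12 [k1 -> [C1 n1]] [k2 -> [C2 n2]] w wW.
have z21 : near B z2 z1 by move=> v vW; rewrite distrC z12.
have k12 := push_le Gg z12 C1 C2 n2; have k21 := push_le Gg z21 C2 C1 n1.
rewrite !raddfB !raddfMn /= !pmulrn !mulrzz !mulNr.
have := z12 _ wW; have := gM _ wW.
move: (pairing w z1) (pairing w z2) (pairing w g) => p1 p2 q hq h.
have -> : p1 - q * k1 + (- p2 - - (q * k2)) =(p1 - p2) + (k2%:Z - k1%:Z) * q by ring.
apply: (le_trans (ler_normD _ _)); rewrite mulnS PoszD PoszM; apply: lerD => //.
by rewrite normrM; apply: ler_pM => //; lia.
Qed.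

Fixpoint push_all gs z r : Prop :=
  if gs is g :: gs' then exists2 y, push g z y & push_all gs' y r else r = z.

Lemma push_all_sub gs z r : {in gs, forall g, pas_set S g} -> C z ->
  push_all gs z r -> C r /\ exists2 s, pas_set S s & z = r + s.
Proof.
elim: gs z => [|g gs IH] z gsS Cz /=.
  by move=> ->; split=> //; exists 0; rewrite ?addr0 //; apply: pas0.
have gsS' : {in gs, forall g, pas_set S g}.
  by move=> h hg; apply: gsS; rewrite inE hg orbT.
move=> [y [k yE [Cy _]] /IH[]// Cr [s Ss yrs]]; split=> //.
exists (s + g *+ k); last by rewrite addrA -yrs yE subrK.
apply: pasD => //; elim: k {yE} => [|k IHk]; first by rewrite mulr0n; apply: pas0.
by rewrite mulrS; apply: pasD => //; apply: gsS; rewrite inE eqxx.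
Qed.

Lemma push_all_exists gs z : {in gs, forall g, pas_set S g /\ g != 0} -> C z ->
  exists r, push_all gs z r.
Proof.
elim: gs z => [|g gs IH] z gsS Cz /=; first by exists z.
have [Sg g0] : pas_set S g /\ g != 0 by apply: gsS; rewrite inE eqxx.
have [y zy] := push_exists Sg g0 Cz; have [_ _ [Cy _]] := zy.
have [|r yr] := IH _ _ Cy; first by move=> h hg; apply: gsS; rewrite inE hg orbT.
by exists r, y.
Qed.

Lemma push_all_lipschitz (B M : nat) gs z1 z2 r1 r2 :
  {in gs, forall g, pas_set S g /\ {in W, forall w, `|pairing w g| <= M%:Z}} ->
  near B z1 z2 -> push_all gs z1 r1 -> push_all gs z2 r2 ->
  near (B * M.+1 ^ size gs) r1 r2.
Proof.
elim: gs B z1 z2 => [|g gs IH] B z1 z2 gsS z12 /=.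
  by move=> -> ->; rewrite expn0 muln1.
move=> [y1 zy1 yr1] [y2 zy2 yr2]; rewrite expnS mulnA.
have [Sg gM] : pas_set S g /\ {in W, forall w, `|pairing w g| <= M%:Z}.
  by apply: gsS; rewrite inE eqxx.
apply: IH yr1 yr2; first by move=> h hg; apply: gsS; rewrite inE hg orbT.
exact: push_lipschitz (gpS Sg) gM z12 zy1 zy2.
Qed.

(** A direction that is blocked stays blocked further down, since [C] is closed under adding S. So
    no nonzero generator can be subtracted from [r], and every nonzero element of S is such a
    generator plus an element of S. *)
Lemma push_all_minimal z r : C z -> push_all [seq g <- gens | g != 0] z r ->
  minimal C r.
Proof.
move=> Cz zr.
have gsS (gs : seq 'rV[int]_n) : {subset gs <= gens} -> {in gs, forall g, pas_set S g}.
  by move=> gg g /gg; apply: gensS.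
have [Cr _] : C r /\ exists2 s, pas_set S s & z = r + s.
  by apply: push_all_sub zr => //; apply: gsS => g; rewrite mem_filter => /andP[].
split=> //.
have stuck gs y : {subset gs <= gens} -> C y -> push_all gs y r ->
    {in gs, forall g, ~ C (r - g)}.
  elim: gs y => [|g gs IH] y //= gg Cy [y' yy' y'r] h.
  have gg' : {subset gs <= gens} by move=> k kg; apply: gg; rewrite inE kg orbT.
  have Cy' : C y' by case: yy' => _ _ [].
  rewrite inE => /orP[/eqP ->|]; last exact: IH gg' Cy' y'r h.
  have [_ [s Ss y'E]] := push_all_sub (gsS _ gg') Cy' y'r.
  case: yy' => _ _ [_ nC] Crg; apply: nC; rewrite y'E addrAC.
  exact: halfspacesD.
have split_gen x : pas_set S x -> x = 0 \/
    exists g, [/\ g \in gens, g != 0 & pas_set S (x - g)].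
  move: x; apply: gens_ind; first by left.
  move=> g x gg Sx IH; have [->|g0] := eqVneq g 0; first by rewrite add0r.
  by right; exists g; rewrite addrC addKr.
move=> s /split_gen[//|[g [gg g0 Sg]]] Crs.
case: (stuck _ _ _ Cz zr g) => [h||]; first by rewrite mem_filter => /andP[].
  by rewrite mem_filter g0.
have -> : r - g = r - s + (s - g) by rewrite addrA subrK.
exact: halfspacesD.
Qed.

Lemma minimal_below z : C z -> exists2 r, minimal C r & pas_set S (z - r).
Proof.
move=> Cz; have [|r zr] := @push_all_exists [seq g <- gens | g != 0] z _ Cz.
  by move=> g; rewrite mem_filter => /andP[g0 /gensS].
exists r; first exact: push_all_minimal zr.
have [|_ [s Ss ->]] := push_all_sub _ Cz zr; last by rewrite addrC addKr.
by move=> g; rewrite mem_filter => /andP[_ /gensS].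
Qed.

End Push.

Lemma gens_bound : exists M : nat,
  {in gens, forall g, {in W, forall w, `|pairing w g| <= M%:Z}}.
Proof.
exists (\max_(g <- gens) \max_(w <- W) absz (pairing w g))%N => g gg w wW.
rewrite -abszE lez_nat.
pose F g := (\max_(w <- W) absz (pairing w g))%N.
apply: (leq_trans _ (leq_bigmax_seq (F := F) _ gg _)) => //.
exact: (leq_bigmax_seq (F := fun w => absz (pairing w g)) _ wW).
Qed.

(* Any two minimal elements are joined in C by steps along generators; the
   Lipschitz retraction of C onto its minimal elements turns this path into a
   chain of minimal elements with steps of bounded length. *)
Lemma minimal_near (m : nat) : exists B : nat, forall b,
  (forall us, uniq us -> {in us, forall u, minimal (halfspaces b) u} ->
     (size us <= m)%N) ->
  forall u v, minimal (halfspaces b) u -> minimal (halfspaces b) v -> near B u v.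
Proof.
have [M gM] := gens_bound.
pose gs := [seq g <- gens | g != 0].
have gsS : {in gs, forall g, pas_set S g /\ {in W, forall w, `|pairing w g| <= M%:Z}}.
  by move=> g; rewrite mem_filter => /andP[_ gg]; split; [apply: gensS|apply: gM].
(* Neighbours on the path are at distance at most [M], enlarged by the factor [M.+1] for each
   generator pushed. *)
pose B := (M * M.+1 ^ size gs)%N.
exists (B * m)%N => b hm u v umin vmin.
pose e : rel 'rV[int]_n := fun x y => `[< minimal (halfspaces b) y /\ near B x y >].
(* Induction along the path from [z] up to [z + s]. Chains are produced in both directions because
   the final path first climbs and then descends. *)
have steps s : pas_set S s -> forall z r r', halfspaces b z ->
    push_all b gs z r -> push_all b gs (z + s) r' ->
    (exists2 p, path e r p & last r p = r') /\ (exists2 p, path e r' p & last r' p = r).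
  move: s; apply: gens_ind => [|g s gg Ss IH] z r r' Cz zr.
    rewrite addr0 => zr'.
    have rr' : near B r r'.
      by apply: push_all_lipschitz gsS _ zr zr' => w _; rewrite subrr normr0.
    split; [exists [:: r']|exists [:: r]] => //=; rewrite andbT; apply/asboolP; split.
    - exact: push_all_minimal zr'.
    - by [].
    - exact: push_all_minimal zr.
    - by move=> w wW; rewrite distrC rr'.
  rewrite [g + s]addrC addrA => zr'.
  have Czs : halfspaces b (z + s) by apply: halfspacesD.
  have Czsg : halfspaces b (z + s + g) by apply: halfspacesD => //; apply: gensS.
  have [|t zt] := @push_all_exists b gs (z + s) _ Czs.
    by move=> h; rewrite mem_filter => /andP[h0 /gensS].
  have [[p ep pt] [q eq qr]] := IH _ _ _ Cz zr zt.
  have tr' : near B t r'.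
    apply: push_all_lipschitz gsS _ zt zr' => w wW.
    by rewrite [pairing w (_ + g)]raddfD /= opprD addNKr normrN gM.
  have tmin : minimal (halfspaces b) t by apply: push_all_minimal zt.
  have rmin : minimal (halfspaces b) r' by apply: push_all_minimal zr'.
  split.
    exists (rcons p r'); last by rewrite last_rcons.
    by rewrite rcons_path ep pt /=; apply/asboolP.
  exists (t :: q) => //=; rewrite eq andbT; apply/asboolP; split=> //.
  by move=> w wW; rewrite distrC tr'.
have fixed x : minimal (halfspaces b) x -> push_all b gs x x.
  move=> [Cx xmin]; have [|r xr] := @push_all_exists b gs x _ Cx.
    by move=> h; rewrite mem_filter => /andP[h0 /gensS].
  have [|Cr [s Ss xE]] := push_all_sub _ Cx xr; first by move=> g /gsS[].
  have s0 : s = 0 by apply: xmin => //; rewrite xE addrK.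
  by rewrite {2}xE s0 addr0.
have [p [ep pv]] : exists p, path e u p /\ last u p = v.
  have [[Gu _] _] := umin; have [[Gv _] _] := vmin.
  have [s Ss [t St st]] : gp S (v - u) by apply: gpB.
  have Cus : halfspaces b (u + s) by apply: halfspacesD => //; case: umin.
  (* The path climbs from [u] to this common point and descends from it to [v]. *)
  have usE : u + s = v + t.
    by rewrite -[s](subrK t) st addrA subrKC.
  have [|r ur] := @push_all_exists b gs (u + s) _ Cus.
    by move=> h; rewrite mem_filter => /andP[h0 /gensS].
  have [[p ep pr] _] := steps s Ss _ _ _ umin.1 (fixed _ umin) ur.
  rewrite usE in ur.
  have [_ [q eq qv]] := steps t St _ _ _ vmin.1 (fixed _ vmin) ur.
  by exists (p ++ q); rewrite cat_path last_cat ep pr eq qv.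
(* Repetitions are cut out, so that the chain consists of distinct minimal elements and has at most
   [m] of them. *)
move: pv; case/shortenP: ep => q eq uq _ qv.
have qmin : {in u :: q, forall x, minimal (halfspaces b) x}.
  move=> x; rewrite inE => /orP[/eqP ->//|].
  elim: (q) (u) eq => //= y q' IH x' /andP[/asboolP[ymin _] q'e].
  by rewrite inE => /orP[/eqP ->//|]; apply: IH q'e.
have {hm uq qmin} qm := hm _ uq qmin.
have : near (B * size q) u v.
  rewrite -qv; elim: (q) (u) eq => /= [|y q' IH] x.
    by move=> _ w _; rewrite subrr normr0.
  move=> /andP[/asboolP[_ xy] q'e] w wW.
  have := IH _ q'e w wW; have := xy w wW; rewrite mulnS PoszD => h1 h2.
  by apply: le_trans (lerD h1 h2); apply: ler_distD.
move=> uv w wW; apply: (le_trans (uv w wW)); rewrite lez_nat leq_mul2l.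
by apply/orP; right; apply: leq_trans qm => /=.
Qed.

(** On the ball each form of [W] takes one of 2B + 1 values, and these values together determine the
    point. *)
Lemma ball_code (B : nat) : exists (T : finType) (f : 'rV[int]_n -> T),
  {in [set x | gp S x /\ near B x 0]%classic &, injective f}.
Proof.
pose c w x := absz (pairing w x + B%:Z).
exists {ffun 'I_(size W) -> 'I_(B + B).+1}.
exists (fun x => [ffun i : 'I_(size W) => inord (c W`_i x)]).
move=> x y /set_mem[Gx xB] /set_mem[Gy yB] /ffunP xy.
apply/eqP; rewrite -subr_eq0; apply/eqP/pas_pairing_eq0; first exact: gpB.
move=> w wW; rewrite raddfB /=.
have wi : (index w W < size W)%N by rewrite index_mem.
have cB z : near B z 0 -> (c w z < (B + B).+1)%N.
  by move=> /(_ _ wW); rewrite raddf0 subr0 /c; lia.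
have := xy (Ordinal wi); rewrite !ffunE /= nth_index // => /(congr1 (@nat_of_ord _)).
rewrite !inordK ?cB //; have := xB _ wW; have := yB _ wW.
by rewrite raddf0 !subr0 /c; lia.
Qed.

End MinimalElements.

(** * The semigroup algebra *)

(* The later arguments take K[S] to be an abstract domain with these properties
   of its constants, monomials and coefficients: unification then never unfolds
   the product of {malg K[elements S]}. *)
Record semigroup_ring (K : fieldType) n (S : positiveAffineSemigroup n)
    (R : idomainType) (cst : K -> R) (mon : 'rV[int]_n -> R)
    (cf : 'rV[int]_n -> R -> K) : Prop := {
  sr_cfD : forall u f g, cf u (f + g) = cf u f + cf u g;
  sr_cfZ : forall c f u, cf u (cst c * f) = c * cf u f;
  sr_cf_pas : forall f u, cf u f != 0 -> pas_set S u;
  sr_cf_eq0 : forall f, f != 0 -> exists u, cf u f != 0;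
  sr_cfM : forall f g u, cf u (f * g) != 0 ->
    exists v w, [/\ u = v + w, cf v f != 0 & cf w g != 0];
  sr_mon0 : mon 0 = 1;
  sr_monD : forall u v, pas_set S u -> pas_set S v -> mon (u + v) = mon u * mon v;
  sr_cf_mon : forall u v, pas_set S u -> cf v (mon u) = (u == v)%:R;
  sr_cfMmon : forall s f u, pas_set S s -> cf (s + u) (mon s * f) = cf u f;
  sr_mon_sum : forall f, exists2 s : seq 'rV[int]_n, {in s, forall u, pas_set S u} &
    f = \sum_(u <- s) cst (cf u f) * mon u;
  sr_mon_divides : forall s f, pas_set S s ->
    (forall u, cf u f != 0 -> pas_set S (u - s)) -> exists g, f = mon s * g;
  sr_gauss : forall w (a : int) f g,
    (forall u, cf u (f * g) != 0 -> a <= pairing w u) ->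
    forall u v, cf u f != 0 -> cf v g != 0 -> a <= pairing w u + pairing w v }.

Section SemigroupAlgebra.
Variables (K : fieldType) (n : nat) (S : positiveAffineSemigroup n).
Notation A := (semigroup_algebra K S).
Notation M := {malg K[elements S]}.
Notation V := 'rV[int]_n.
Implicit Types (u v s t : V) (f g r : A) (k : elements S).

(** Extended by zero from S to all of Z^n, so that exponents can be shifted freely. *)
Definition cf u f : K := if insub u is Some k then (f : M)@_k else 0.

Definition mon u : A := if insub u is Some k then (<< k >> : M) else 0.

Lemma cf_val f k : cf (val k) f = (f : M)@_k.
Proof. by rewrite /cf valK. Qed.

Lemma elements_of u : pas_set S u -> exists k : elements S, val k = u.
Proof. by move=> /mem_set Su; exists (exist _ u Su). Qed.

Lemma cf_neq0 f u : cf u f != 0 -> exists2 k : elements S, val k = u & (f : M)@_k != 0.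
Proof.
rewrite /cf; case: insubP => [k _ ku|]; last by rewrite eqxx.
by move=> fk; exists k.
Qed.

Lemma cf_pas f u : cf u f != 0 -> pas_set S u.
Proof. by move=> /cf_neq0[k <- _]; apply/set_mem/valP. Qed.

Lemma cfD f g u : cf u (f + g) = cf u f + cf u g.
Proof. by rewrite /cf; case: insub => [k|]; rewrite ?addr0 // (@mcoeffD _ K). Qed.

Lemma cfN f u : cf u (- f) = - cf u f.
Proof. by rewrite /cf; case: insub => [k|]; rewrite ?oppr0 // (@mcoeffN _ K). Qed.

Lemma cf_is_additive u : additive (cf u).
Proof. by move=> f g; rewrite cfD cfN. Qed.

HB.instance Definition _ u := GRing.isAdditive.Build A K (cf u) (cf_is_additive u).

Lemma cfP f g : (forall u, cf u f = cf u g) -> f = g.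
Proof. by move=> fg; apply/(@malgP _ K) => k; rewrite -!cf_val. Qed.

Lemma cf_eq0 f : f != 0 -> exists u, cf u f != 0.
Proof.
move=> f0; apply: contrapT => h; move/eqP: f0; apply; apply: cfP => u.
by rewrite raddf0; apply: contrapT => /eqP fu; apply: h; exists u.
Qed.

Lemma mon_val k : mon (val k) = << k >> :> M.
Proof. by rewrite /mon valK. Qed.

Lemma cf_mon u v : pas_set S u -> cf v (mon u) = (u == v)%:R.
Proof.
move=> /elements_of[k <-]; rewrite /cf mon_val.
case: insubP => [j _ <-|vS]; first by rewrite mcoeffU1 (inj_eq val_inj).
by case: eqP => // kv; rewrite -kv (valP k) in vS.
Qed.

Lemma cfM f g u : cf u (f * g) != 0 ->
  exists v w, [/\ u = v + w, cf v f != 0 & cf w g != 0].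
Proof.
move=> /cf_neq0[k <-]; rewrite mcoeff_neq0 => /msuppM_le[k1 [k2 [h1 h2 ->]]].
by exists (val k1), (val k2); rewrite !cf_val !mcoeff_neq0.
Qed.

Lemma monD u v : pas_set S u -> pas_set S v -> mon (u + v) = mon u * mon v.
Proof.
move=> /elements_of[k <-] /elements_of[j <-].
rewrite -[val k + val j]/(val (mmul k j)) !mon_val.
by rewrite malgM_def fgmulUU mulr1.
Qed.

Lemma mon0 : mon 0 = 1.
Proof. by rewrite -[0]/(val (mone : elements S)) mon_val. Qed.

Definition cst (c : K) : A := (c%:MP : M).

Lemma cfZ (c : K) f u : cf u (cst c * f) = c * cf u f.
Proof. by rewrite /cf; case: insub => [k|]; rewrite ?mulr0 // mcoeffCM. Qed.

Lemma malgU_mon (c : K) k : (<< c *g k >> : M) = cst c * mon (val k).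
Proof.
apply: cfP => u; rewrite cfZ cf_mon; last exact/set_mem/valP.
rewrite /cf; case: insubP => [j _ <-|uS].
  by rewrite mcoeffU (inj_eq val_inj) mulr_natr.
by case: eqP => [ku|]; rewrite ?mulr0 //; rewrite -ku (valP k) in uS.
Qed.

Lemma mon_sum f : f = \sum_(k <- msupp (f : M)) cst (cf (val k) f) * mon (val k).
Proof.
rewrite [LHS](@monalgE _ K); apply: eq_bigr => k _.
by rewrite cf_val malgU_mon.
Qed.

Lemma cfMmon s f u : pas_set S s -> cf (s + u) (mon s * f) = cf u f.
Proof.
move=> Ss; rewrite {2}(mon_sum f) {1}(mon_sum f) mulr_sumr !raddf_sum /=.
apply: eq_bigr => k _; have Sk : pas_set S (val k) by apply/set_mem/valP.
rewrite mulrCA -(monD Ss Sk) !cfZ !cf_mon //; last exact: pasD.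
by rewrite (inj_eq (addrI s)).
Qed.

Lemma mon_divides s f : pas_set S s -> (forall u, cf u f != 0 -> pas_set S (u - s)) ->
  exists g, f = mon s * g.
Proof.
move=> Ss fs.
exists (\sum_(k <- msupp (f : M)) cst (cf (val k) f) * mon (val k - s)).
rewrite {1}(mon_sum f) mulr_sumr; apply: eq_bigr => k _.
have [->|k0] := eqVneq (cf (val k) f) 0.
  by rewrite [cst 0](@malgC0E _ K) !mul0r mulr0.
by rewrite mulrCA -monD ?subrKC //; apply: fs.
Qed.

(* The lowest parts f0 and g0 of f and g with respect to w have nonzero product
   since K[S] is a domain, and it is the lowest part of f * g. *)
Lemma gauss (w : 'cV[int]_n) (a : int) f g :
  (forall u, cf u (f * g) != 0 -> a <= pairing w u) ->
  forall u v, cf u f != 0 -> cf v g != 0 -> a <= pairing w u + pairing w v.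
Proof.
have lowest f1 u1 : cf u1 f1 != 0 -> exists p f0,
    [/\ f0 != 0, forall u, cf u f1 != 0 -> p <= pairing w u,
        forall u, cf u f0 != 0 -> pairing w u = p &
        forall u, cf u (f1 - f0) != 0 -> p < pairing w u].
  move=> /cf_neq0[k1 _]; rewrite mcoeff_neq0 => k1f.
  have [|k kf kmin] := @seq_max _ _ int (msupp (f1 : M) : seq _)
    (fun k => - pairing w (val k)).
    by move=> e; rewrite -[_ \in _]/(k1 \in (msupp (f1 : M) : seq _)) e in k1f.
  pose p := pairing w (val k).
  pose f0 : M := [malg j in msupp (f1 : M) =>
    if pairing w (val j) == p then (f1 : M)@_j else 0].
  have f0E j : f0@_j = if pairing w (val j) == p then (f1 : M)@_j else 0.
    rewrite /f0 mcoeffE; case: ifP => // /negbT /mcoeff_outdom ->.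
    by rewrite if_same.
  have pmin u : cf u f1 != 0 -> p <= pairing w u.
    by move=> /cf_neq0[j <-]; rewrite mcoeff_neq0 => /kmin; rewrite lerN2.
  exists p, f0; split=> //.
  - apply/eqP => f00; have fk : (f1 : M)@_k != 0 by rewrite mcoeff_neq0.
    by case/eqP: fk; have := f0E k; rewrite f00 mcoeff0 eqxx.
  - by move=> u /cf_neq0[j <-]; rewrite f0E; case: (_ =P p); rewrite ?eqxx.
  - move=> u /cf_neq0[j <-]; rewrite (@mcoeffB _ K) f0E.
    case: (_ =P p); rewrite ?subrr ?eqxx // => jp; rewrite subr0 -cf_val => /pmin.
    by rewrite le_eqVlt => /orP[/eqP jp'|//]; case: jp.
move=> fgP u v fu gv.
have [p [f0 [f00 pf pf0 pf1]]] := lowest _ _ fu.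
have [q [g0 [g00 qg qg0 qg1]]] := lowest _ _ gv.
have [x xfg] : exists x, cf x (f0 * g0) != 0 by apply/cf_eq0/mulf_neq0.
have xpq : pairing w x = p + q.
  by have [y [z [-> /pf0 yp /qg0 zq]]] := cfM xfg; rewrite raddfD /= yp zq.
have : cf x (f * g) != 0.
  (* The last two terms only have exponents of weight above [p + q], so they contribute nothing at
     [x]. *)
  have e : f * g = f0 * g0 + (f0 * (g - g0) + (f - f0) * g) by ring.
  have {}e : cf x (f * g) =
      cf x (f0 * g0) + (cf x (f0 * (g - g0)) + cf x ((f - f0) * g)).
    by rewrite e cfD (cfD (f0 * _)).
  suff [h1 h2] : cf x (f0 * (g - g0)) = 0 /\ cf x ((f - f0) * g) = 0.
    have add00 (a1 b c d : K) : d = a1 + (b + c) -> b = 0 -> c = 0 -> a1 != 0 -> d != 0.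
      by move=> -> -> ->; rewrite !addr0.
    exact: (add00 _ _ _ _ e h1 h2 xfg).
  split; apply: contrapT => /eqP /cfM[y [z [xyz]]]; move: xpq; rewrite xyz raddfD /=.
    by move=> yz /pf0 yp /qg1 zq; move: yz; rewrite yp => /addrI zq'; rewrite zq' ltxx in zq.
  by move=> yz /pf1 yp /qg zq; have := ltr_leD yp zq; rewrite yz ltxx.
move=> /fgP; rewrite xpq => apq; apply: (le_trans apq).
by apply: lerD; [apply: pf|apply: qg].
Qed.

Lemma cst_is_additive : additive cst.
Proof. by move=> c d; rewrite /cst (@monalgUB _ K). Qed.

Lemma cst_is_multiplicative : multiplicative cst.
Proof. by split=> [c d|]; rewrite /cst ?mpolyCM // mpolyC1E. Qed.

HB.instance Definition _ := GRing.isAdditive.Build K A cst cst_is_additive.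
HB.instance Definition _ := GRing.isMultiplicative.Build K A cst cst_is_multiplicative.

Lemma semigroup_algebra_ring : semigroup_ring S cst mon cf.
Proof.
split; [by move=> u f g; apply: cfD|exact: cfZ|exact: cf_pas|exact: cf_eq0|
  exact: cfM|exact: mon0|exact: monD|exact: cf_mon|exact: cfMmon| |exact: mon_divides|exact: gauss].
move=> f; exists [seq val k | k <- msupp (f : M)].
  by move=> _ /mapP[k _ ->]; apply/set_mem/valP.
by rewrite big_map; apply: mon_sum.
Qed.

End SemigroupAlgebra.

(** * Laurent polynomials and monomial divisorial ideals *)

Lemma cross_multiply (F : fieldType) (a b c p q r s : F) :
  p != 0 -> q != 0 -> r != 0 -> s != 0 ->
  a / p * (b / q) / s = c / r -> a * b * r = s * (c * p * q).
Proof.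
move=> p0 q0 r0 s0 e.
transitivity (a / p * (b / q) / s * (p * q * s * r)); first by field; rewrite p0 q0 s0.
by rewrite e; field.
Qed.

Section Laurent.
Variables (K : fieldType) (n : nat) (S : positiveAffineSemigroup n) (R : idomainType).
Variables (cst : {rmorphism K -> R}) (mon : 'rV[int]_n -> R) (cf : 'rV[int]_n -> R -> K).
Hypothesis RS : semigroup_ring S cst mon cf.
Notation F := {fraction R}.
Notation V := 'rV[int]_n.
Notation "x %:F" := (@tofrac R x).
Implicit Types (u v s t : V) (f g r : R) (l h d : F).

Let cfD := sr_cfD RS.
Let cfZ := sr_cfZ RS.
Let cf_pas := sr_cf_pas RS.
Let cf_eq0 := sr_cf_eq0 RS.
Let cfM := sr_cfM RS.
Let mon0 := sr_mon0 RS.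
Let monD := sr_monD RS.
Let cf_mon := sr_cf_mon RS.
Let cfMmon := sr_cfMmon RS.

Lemma cf0 u : cf u 0 = 0.
Proof. by apply: (addrI (cf u 0)); rewrite -cfD !addr0. Qed.

Lemma cf_mon_shift s f u : pas_set S s -> cf u (mon s * f) = cf (u - s) f.
Proof. by move=> Ss; rewrite -{1}[u](subrKC s) cfMmon. Qed.

Lemma mon_neq0 s : pas_set S s -> mon s != 0.
Proof.
move=> Ss; apply/eqP => s0; have /eqP := cf_mon s Ss.
by rewrite s0 cf0 eqxx eq_sym oner_eq0.
Qed.

Lemma monF_neq0 s : pas_set S s -> (mon s)%:F != 0.
Proof. by move=> Ss; rewrite tofrac_eq0 mon_neq0. Qed.

(** The ring K[gp(S)] inside Frac R: fractions with a monomial as denominator. *)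
Definition laurent l : Prop := exists s r, pas_set S s /\ l * (mon s)%:F = r%:F.

Definition lsupp l : set V := [set u | exists s r,
  [/\ pas_set S s, l * (mon s)%:F = r%:F & cf (u + s) r != 0]]%classic.

Lemma lsuppE l s r u : pas_set S s -> l * (mon s)%:F = r%:F ->
  lsupp l u <-> cf (u + s) r != 0.
Proof.
move=> Ss ls; split=> [[t [r' [St lt r'u]]]|ru]; last by exists s, r.
have e : mon t * r = mon s * r'.
  by apply/eqP; rewrite -tofrac_eq !tofracM -ls -lt mulrCA mulrA mulrC mulrA.
rewrite -(cfMmon r _ St) e addrC -addrA [s + t]addrC addrA cf_mon_shift //.
by rewrite addrK.
Qed.

Lemma lsupp_gp l u : lsupp l u -> gp S u.
Proof.
by move=> [s [r [Ss _ /cf_pas Sus]]]; exists (u + s) => //; exists s; rewrite ?addrK.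
Qed.

Lemma lsupp_tofrac r u : lsupp r%:F u <-> cf u r != 0.
Proof. by rewrite (@lsuppE _ 0 r) ?addr0 //; [apply: pas0|rewrite mon0 tofrac1 mulr1]. Qed.

Lemma laurent_tofrac r : laurent r%:F.
Proof. by exists 0, r; rewrite mon0 tofrac1 mulr1; split=> //; apply: pas0. Qed.

Lemma laurent1 : laurent 1. Proof. by rewrite -tofrac1; apply: laurent_tofrac. Qed.

Lemma laurentM l h : laurent l -> laurent h -> laurent (l * h).
Proof.
move=> [s [r [Ss ls]]] [t [q [St ht]]]; exists (s + t), (r * q).
by split; [apply: pasD|rewrite monD // !tofracM mulrACA ls ht].
Qed.

Lemma laurentD l h : laurent l -> laurent h -> laurent (l + h).
Proof.
move=> [s [r [Ss ls]]] [t [q [St ht]]]; exists (s + t), (r * mon t + q * mon s).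
split; first exact: pasD.
by rewrite monD // tofracD !tofracM -ls -ht; ring.
Qed.

Lemma lsuppM l h u : laurent l -> laurent h -> lsupp (l * h) u ->
  exists v w, [/\ u = v + w, lsupp l v & lsupp h w].
Proof.
move=> [s [r [Ss ls]]] [t [q [St ht]]].
have Sst := pasD Ss St.
have e : l * h * (mon (s + t))%:F = (r * q)%:F.
  by rewrite monD // !tofracM mulrACA ls ht.
move=> /(lsuppE _ Sst e) /cfM[v [w [uvw rv qw]]].
exists (v - s), (w - t); split.
- by rewrite addrACA -opprD -uvw addrK.
- by apply/(lsuppE _ Ss ls); rewrite subrK.
- by apply/(lsuppE _ St ht); rewrite subrK.
Qed.

Lemma lsupp_neq0 l : laurent l -> l != 0 -> exists u, lsupp l u.
Proof.
move=> [s [r [Ss ls]]] l0.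
have [|u ru] := @cf_eq0 r; last by exists (u - s); apply/(lsuppE _ Ss ls); rewrite subrK.
by rewrite -tofrac_eq0 -ls mulf_neq0 // monF_neq0.
Qed.

Lemma range_tofracP l : range (@tofrac R) l <-> laurent l /\ (lsupp l `<=` pas_set S)%classic.
Proof.
split=> [[r _ <-]|[[s [r [Ss ls]]] lS]].
  by split=> [|u /lsupp_tofrac /cf_pas //]; apply: laurent_tofrac.
have [u ru|g rg] := sr_mon_divides RS Ss (f := r).
  by apply: lS; apply/(lsuppE _ Ss ls); rewrite subrK.
by exists g => //; apply: (mulIf (monF_neq0 Ss)); rewrite ls rg tofracM mulrC.
Qed.

(** The Laurent monomial of exponent [u] in gp(S), independent of the choice of [s] and [t] by
    [chiE]; outside gp(S) the value is 0. *)
Definition chi u : F :=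
  xget 0 [set l | exists s t, [/\ pas_set S s, pas_set S t, u = s - t &
                                 l = (mon s)%:F / (mon t)%:F]]%classic.

Lemma chiE s t : pas_set S s -> pas_set S t -> chi (s - t) = (mon s)%:F / (mon t)%:F.
Proof.
move=> Ss St; rewrite /chi.
case: xgetP => [l _ [s' [t' [Ss' St' e ->]]]|/(_ ((mon s)%:F / (mon t)%:F))[]]; last first.
  by exists s, t.
have st' : s' + t = s + t'.
  by apply/eqP; rewrite -subr_eq addrAC -e subrK.
apply/eqP; rewrite eqr_div ?monF_neq0 // -!tofracM tofrac_eq.
by rewrite -!monD // st' addrC.
Qed.

Lemma chi_mon u t : gp S u -> pas_set S t -> pas_set S (u + t) ->
  chi u * (mon t)%:F = (mon (u + t))%:F.
Proof.
move=> Gu St Sut; rewrite -{1}[u](addrK t) chiE // divfK //; exact: monF_neq0.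
Qed.

Lemma chi_pas s : pas_set S s -> chi s = (mon s)%:F.
Proof. by move=> Ss; rewrite -{1}[s]subr0 chiE ?mon0 ?tofrac1 ?divr1 //; apply: pas0. Qed.

Lemma chi0 : chi 0 = 1.
Proof. by rewrite chi_pas ?mon0 ?tofrac1 //; apply: pas0. Qed.

Lemma chiD u v : gp S u -> gp S v -> chi (u + v) = chi u * chi v.
Proof.
move=> [a Sa [b Sb <-]] [c Sc [d Sd <-]].
rewrite addrACA -opprD !chiE //; try exact: pasD.
by rewrite !monD // !tofracM mulf_div.
Qed.

Lemma chi_neq0 u : gp S u -> chi u != 0.
Proof.
move=> Gu; have /eqP := chi0; rewrite -(subrr u) chiD //; last exact: gpN.
by apply: contraTneq => ->; rewrite mul0r eq_sym oner_eq0.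
Qed.

Lemma laurent_chi u : gp S u -> laurent (chi u).
Proof.
move=> [a Sa [b Sb <-]]; exists b, (mon a); split=> //.
by rewrite chiE // divfK // monF_neq0.
Qed.

Lemma lsupp_chi u v : gp S u -> lsupp (chi u) v <-> v = u.
Proof.
move=> [a Sa [b Sb <-]].
rewrite (@lsuppE _ b (mon a)) //; last by rewrite chiE // divfK // monF_neq0.
rewrite cf_mon //; split=> [|->]; last by rewrite subrK eqxx oner_eq0.
by case: (a =P v + b) => [-> _|_]; rewrite ?addrK ?eqxx.
Qed.

Definition lspan (C : set V) : set F :=
  [set l | laurent l /\ (lsupp l `<=` C)%classic]%classic.

(** * Divisorial ideals with trivial gcd in the Laurent ring *)

Section Divisorial.
Variable W : seq 'cV[int]_n.
Hypothesis WP : forall x, pas_set S x <-> gp S x /\ {in W, forall w, 0 <= pairing w x}.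

(** By [sr_gauss] the minimum of a form on the support is additive on products, so a lower bound on
    the support of [l * h] holds for all sums of support points. *)
Lemma lsupp_add_pas l h : laurent l -> laurent h -> range (@tofrac R) (l * h) ->
  forall u v, lsupp l u -> lsupp h v -> pas_set S (u + v).
Proof.
move=> [s [r [Ss ls]]] [t [q [St ht]]] /range_tofracP[_ lhS] u v lu hv.
have Sst := pasD Ss St.
apply/WP; split; first by apply: gpD; [apply: lsupp_gp lu|apply: lsupp_gp hv].
move=> w wW.
have h0 x : cf x (r * q) != 0 -> pairing w (s + t) <= pairing w x.
  move=> rqx; rewrite -subr_ge0 -raddfB.
  have /lhS/WP[_] : lsupp (l * h) (x - (s + t)); last exact.
  apply/(@lsuppE _ (s + t) (r * q)); rewrite ?subrK //.
  by rewrite monD // !tofracM mulrACA ls ht.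
have := sr_gauss RS h0 (iffLR (lsuppE _ Ss ls) lu) (iffLR (lsuppE _ St ht) hv).
by rewrite !raddfD /=; lia.
Qed.

(** The last hypothesis says that [D] has gcd 1 among the Laurent polynomials, which forces R : D
    into them. Then R : D and its inverse are spanned by monomials, with exponent sets [T1] and
    [T2]. *)
Lemma lspan_divisorial (D : set F) : (exists2 g : F, D g & g != 0) ->
  (exists d, [/\ d != 0, laurent d & forall g : F, D g -> range (@tofrac R) (d * g)]) ->
  inverse_ideal (inverse_ideal D) = D ->
  (forall x, (forall g : F, D g -> laurent (x * g)) <-> laurent x) ->
  exists b, D = lspan (halfspaces S W b).
Proof.
move=> [g0 Dg0 g00] [d [d0 Ld dD]] DE DL.
have Dl (g : F) : D g -> laurent g.
  by rewrite -[g in laurent g]mul1r; move: g; apply/DL/laurent1.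
pose T1 := [set u | gp S u /\ forall (g : F) v, D g -> lsupp g v -> pas_set S (u + v)]%classic.
have E1 : inverse_ideal D = lspan T1.
  apply/seteqP; split=> x.
    move=> Dx; have Lx : laurent x.
      by apply/DL => g /Dx [r _ <-]; apply: laurent_tofrac.
    split=> // u xu; split; first exact: lsupp_gp xu.
    by move=> g v Dg gv; apply: lsupp_add_pas xu gv => //; [apply: Dl|apply: Dx].
  move=> [Lx xT1] g Dg; apply/range_tofracP; split.
    by apply: laurentM => //; apply: Dl.
  by move=> u /(lsuppM Lx (Dl _ Dg))[v [w [-> /xT1[_ vT] gw]]]; apply: vT gw.
have [w0 w0T1] : exists w0, T1 w0.
  have [w0 dw0] := lsupp_neq0 Ld d0.
  exists w0; split; first exact: lsupp_gp dw0.
  move=> g v Dg gv; apply: lsupp_add_pas dw0 gv => //; first exact: Dl.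
  exact: dD.
pose T2 := [set u | gp S u /\ forall t, T1 t -> pas_set S (u + t)]%classic.
have E2 : D = lspan T2.
  rewrite -DE E1; apply/seteqP; split=> x.
    move=> Dx.
    have chiT t : T1 t -> range (@tofrac R) (x * chi t).
      move=> tT; have Gt : gp S t by case: tT.
      by apply: Dx; split; [exact: laurent_chi|move=> v /(lsupp_chi _ Gt) ->].
    have Gw0 : gp S w0 by case: w0T1.
    (* The product of [x] with one monomial of exponent in [T1] lies in R, and monomials are Laurent
       units. *)
    have Lx : laurent x.
      rewrite -[x](mulfK (chi_neq0 Gw0)); apply: laurentM.
        by have [r _ <-] := chiT _ w0T1; apply: laurent_tofrac.
      have <- : chi (- w0) = (chi w0)^-1.
        apply: (mulfI (chi_neq0 Gw0)); rewrite mulfV ?chi_neq0 //.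
        by rewrite -chiD ?subrr ?chi0 //; apply: gpN.
      by apply: laurent_chi; apply: gpN.
    split=> // u xu; split; first exact: lsupp_gp xu.
    move=> t tT; have Gt : gp S t by case: tT.
    apply: lsupp_add_pas (laurent_chi Gt) (chiT _ tT) _ _ xu _ => //.
    exact/lsupp_chi.
  move=> [Lx xT2] l [Ll lT1]; apply/range_tofracP; split; first exact: laurentM.
  by move=> u /(lsuppM Lx Ll)[v [w [-> /xT2[_ vT] /lT1 lw]]]; apply: vT.
have [u0 gu0] := lsupp_neq0 (Dl _ Dg0) g00.
(* The minimum of [w] on [T1] exists since [T1] translated by [u0] lies in S; its opposite is the
   bound on [T2]. The value 0 outside [W] is arbitrary. *)
have T1min w : exists c : int, w \in W ->
    (exists2 t, T1 t & pairing w t = c) /\ (forall t, T1 t -> c <= pairing w t).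
  have [wW|_] := boolP (w \in W); last by exists 0.
  have T1ge0 t : T1 t -> 0 <= pairing w (t + u0).
    by move=> [_ tT]; have /WP[_] := tT _ _ Dg0 gu0; exact.
  have ex : exists k, `[< exists2 t, T1 t & absz (pairing w (t + u0)) = k >].
    by exists (absz (pairing w (w0 + u0))); apply/asboolP; exists w0.
  case: (ex_minnP ex) => k /asboolP[t tT tk] kmin.
  exists (pairing w t) => _; split; first by exists t.
  move=> t' t'T; have : (k <= absz (pairing w (t' + u0)))%N.
    by apply: kmin; apply/asboolP; exists t'.
  have := T1ge0 _ tT; have := T1ge0 _ t'T; rewrite -tk !raddfD /=.
  by lia.
have [c cP] := choice T1min.
exists (fun w => - c w); rewrite E2; congr lspan.
apply/seteqP; split=> u [Gu uP]; split=> //.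
  move=> w wW; have [[t tT <-] _] := cP _ wW.
  by have /WP[_ /(_ _ wW)] := uP _ tT; rewrite raddfD /=; lia.
move=> t tT; have Gt : gp S t by case: tT.
apply/WP; split; first exact: gpD.
move=> w wW; have [_ /(_ _ tT)] := cP _ wW; have := uP _ wW.
by rewrite raddfD /=; lia.
Qed.

End Divisorial.

(** * Factoriality of the Laurent ring *)

Lemma laurent_sum (I : Type) (r : seq I) (h : I -> F) :
  (forall i, laurent (h i)) -> laurent (\sum_(i <- r) h i).
Proof.
move=> hL; elim/big_ind: _ => //; last exact: laurentD.
by rewrite -tofrac0; apply: laurent_tofrac.
Qed.

Lemma cf_sum u (I : Type) (r : seq I) (f : I -> R) :
  cf u (\sum_(i <- r) f i) = \sum_(i <- r) cf u (f i).
Proof. exact: (big_morph (cf u) (cfD u) (cf0 u)). Qed.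

Lemma common_shift (ws : seq V) : {in ws, forall w, gp S w} ->
  exists2 t, pas_set S t & {in ws, forall w, pas_set S (w + t)}.
Proof.
elim: ws => [|w ws IH] wsG; first by exists 0 => //; apply: pas0.
have [|t St tws] := IH; first by move=> v vw; apply: wsG; rewrite inE vw orbT.
have [a Sa [b Sb abw]] : gp S w by apply: wsG; rewrite inE eqxx.
exists (t + b); first exact: pasD.
move=> v; rewrite inE => /orP[/eqP ->|/tws Svt].
  by rewrite -abw [t + b]addrC addrA subrK; apply: pasD.
by rewrite addrA; apply: pasD.
Qed.

Lemma gp_mulrz u (z : int) : gp S u -> gp S (u *~ z).
Proof. by move=> Gu; apply: subgroupMz => //; [apply: gp0|move=> *; apply: gpB]. Qed.

Lemma chiX u (k : nat) : gp S u -> chi (u *+ k) = chi u ^+ k.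
Proof.
move=> Gu; elim: k => [|k IH]; first by rewrite mulr0n chi0 expr0.
by rewrite mulrS exprS chiD ?IH // pmulrn; apply: gp_mulrz.
Qed.

Lemma chiN u : gp S u -> chi (- u) = (chi u)^-1.
Proof.
move=> Gu; apply: (mulfI (chi_neq0 Gu)); rewrite mulfV ?chi_neq0 //.
by rewrite -chiD ?subrr ?chi0 //; apply: gpN.
Qed.

(** The exponents lie in distinct cosets of the span of [bs]. The single exponent 0 gives
    injectivity of [theta]; the general form is what carries over when a basis vector is
    adjoined. *)
Definition chi_independent (bs : seq V) (P : idomainType) (theta : P -> F) : Prop :=
  forall (I : finType) (w : I -> V) (p : I -> P), (forall i, gp S (w i)) ->
    (forall i j, int_span bs (w i - w j) -> i = j) ->
    \sum_i theta (p i) * chi (w i) = 0 -> forall i, p i = 0.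

Lemma chi_independent_cst : chi_independent [::] (fun c : K => (cst c)%:F).
Proof.
move=> I w p wG winj sum0 i.
have [|t St wt] := @common_shift [seq w j | j : I].
  by move=> _ /mapP[j _ ->].
have {}wt j : pas_set S (w j + t) by apply/wt/codom_f.
have {sum0} : \sum_j cst (p j) * mon (w j + t) = 0.
  apply/eqP; rewrite -tofrac_eq0 rmorph_sum /=.
  under eq_bigr do rewrite tofracM -chi_mon // mulrA.
  by rewrite -mulr_suml sum0 mul0r.
move=> /(congr1 (cf (w i + t))); rewrite cf0 cf_sum (bigD1 i) //= big1 => [|j ji].
  by rewrite addr0 cfZ cf_mon // eqxx mulr1.
rewrite cfZ cf_mon //; case: eqP => [/addIr wji|]; last by rewrite mulr0.
by case/eqP: ji; apply: winj; rewrite /= wji subrr.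
Qed.

(** Expanding the polynomials gives the exponents [w i + b *+ k], which stay distinct modulo the
    span of [bs] because [b] has infinite order there. *)
Lemma chi_independentS b (bs : seq V) (P : idomainType) (theta : {rmorphism P -> F})
    (cb : commr_rmorph theta (chi b)) : gp S b ->
  (forall z : int, int_span bs (b *~ z) -> z = 0) ->
  chi_independent bs theta -> chi_independent (b :: bs) (horner_morph cb).
Proof.
move=> Gb bfree ind I w p wG winj sum0.
pose N := (\max_i size (p i))%N.
have pN i : (size (p i) <= N)%N by apply: leq_bigmax.
pose w' (ik : I * 'I_N) := w ik.1 + b *+ ik.2.
pose p' (ik : I * 'I_N) := (p ik.1)`_ik.2.
suff p'0 : forall ik, p' ik = 0.
  move=> i; apply/polyP => k; rewrite coef0; have [kN|Nk] := ltnP k N.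
    exact: (p'0 (i, Ordinal kN)).
  by rewrite nth_default // (leq_trans (pN i)).
apply: (ind _ w').
- by move=> [i k]; apply: gpD => //; rewrite pmulrn; apply: gp_mulrz.
- move=> [i k] [j l]; rewrite /w' /= => ijkl.
  have ij : i = j.
    apply: winj; exists (l%:Z - k%:Z); move: ijkl; congr (int_span bs _).
    by rewrite mulrzBr -!pmulrn opprB opprD addrACA.
  move: ijkl; rewrite ij opprD addrACA subrr add0r => kl.
  have : k%:Z - l%:Z = 0 by apply: bfree; rewrite mulrzBr -!pmulrn.
  by move=> /subr0_eq [] kl'; congr pair; apply/val_inj.
- rewrite -(pair_bigA _ (fun i k => theta (p' (i, k)) * chi (w' (i, k)))) /= -[RHS]sum0.
  apply: eq_bigr => i _; rewrite /horner_morph (@horner_coef_wide _ N); last first.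
    exact: leq_trans (size_poly _ _) (pN i).
  rewrite mulr_suml; apply: eq_bigr => k _.
  rewrite /p' /w' /= chiD ?chiX //; last by rewrite pmulrn; apply: gp_mulrz.
  by rewrite coef_map /= mulrAC mulrA.
Qed.

(* Adjoining the basis vectors one at a time, K[x_1, ..., x_d] is embedded in
   Frac K[S] so that its localization at the variables is the group algebra. *)
Lemma laurent_model (bs : seq V) : {in bs, forall b, gp S b} -> int_free bs ->
  exists (P : idomainType) (theta : {rmorphism P -> F}),
    [/\ factorial_domain P, chi_independent bs theta, forall p, laurent (theta p),
        forall c, exists p, theta p = (cst c)%:F &
        {in bs, forall b, exists p, theta p = chi b}].
Proof.
elim: bs => [|b bs IH] bsG bsF.
  exists K, (@tofrac R \o cst); split=> //=.
  - exact: factorial_field.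
  - exact: chi_independent_cst.
  - by move=> c; apply: laurent_tofrac.
  - by move=> c; exists c.
have [bfree bsF'] := bsF.
have [|//|P [theta [Pf ind thL thC thb]]] := IH.
  by move=> c cbs; apply: bsG; rewrite inE cbs orbT.
have Gb : gp S b by apply: bsG; rewrite inE eqxx.
have cb : commr_rmorph theta (chi b) by move=> p; apply: mulrC.
exists {poly P}, (horner_morph cb); split.
- exact: factorial_poly.
- exact: chi_independentS.
- move=> p; rewrite /= /horner_morph horner_coef; apply: laurent_sum => i.
  rewrite coef_map -chiX //; apply: laurentM; [exact: thL|apply: laurent_chi].
  by rewrite pmulrn; apply: gp_mulrz.
- by move=> c; have [p pc] := thC c; exists p%:P; rewrite /= horner_morphC.
- move=> c; rewrite inE => /orP[/eqP ->|/thb[p pc]].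
    by exists 'X; rewrite /= horner_morphX.
  by exists p%:P; rewrite /= horner_morphC.
Qed.

(** Every Laurent polynomial is a fraction of images of elements of [P] whose denominator is a
    Laurent unit. Primes of [P] become primes or units there, so a multiple of [g0] factors into
    primes and [gcd_exists] applies. *)
Lemma laurent_gcd (D : set F) : (exists2 g : F, D g & g != 0) ->
  (exists2 d, d != 0 & forall g : F, D g -> range (@tofrac R) (d * g)) ->
  exists2 f : F, f != 0 &
    forall x, (forall g : F, D g -> laurent (x * g)) <-> laurent (x * f).
Proof.
move=> [g0 Dg0 g00] [d d0 dD].
have [bs [bsG bsF bsS]] := lattice_basis (gp0 S) (@gpB _ S).
have [P [theta [Pf ind thL thC thb]]] := laurent_model bsG bsF.
have th_inj p : theta p = 0 -> p = 0.
  move=> p0; apply: (ind unit (fun=> 0) (fun=> p) _ _ _ tt).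
  - by move=> _; apply: gp0.
  - by move=> [] [].
  - by rewrite big1 // => i _; rewrite p0 mul0r.
have th_neq0 p : p != 0 -> theta p != 0.
  by move=> p0; apply: contraNneq p0 => /th_inj ->.
pose Q l := exists p m, [/\ theta m != 0, laurent (theta m)^-1 & l = theta p / theta m].
have Qth p : Q (theta p).
  by exists p, 1; rewrite rmorph1 invr1 mulr1 oner_eq0; split=> //; apply: laurent1.
have QM l h : Q l -> Q h -> Q (l * h).
  move=> [p [m [m0 Lm ->]]] [q [k [k0 Lk ->]]]; exists (p * q), (m * k).
  rewrite !rmorphM mulf_neq0 // invfM mulf_div invfM; split=> //.
  exact: laurentM.
have QD l h : Q l -> Q h -> Q (l + h).
  move=> [p [m [m0 Lm ->]]] [q [k [k0 Lk ->]]]; exists (p * k + q * m), (m * k).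
  rewrite rmorphD !rmorphM mulf_neq0 // addf_div // invfM; split=> //.
  exact: laurentM.
have Qchi u : gp S u -> Q (chi u).
  move=> Gu; suff : gp S u /\ Q (chi u) by case.
  apply: (@int_span_ind _ bs (fun v => gp S v /\ Q (chi v)) u _ _ (bsS _ Gu)).
    by split; [apply: gp0|rewrite chi0 -(rmorph1 theta)].
  move=> b z x bbs [Gx Qx]; have Gb := bsG _ bbs; have Gbz := gp_mulrz z Gb.
  split; first exact: gpD.
  rewrite chiD //; apply: QM => //; have [p pb] := thb _ bbs.
  case: z Gbz => k Gbz; first by rewrite -pmulrn chiX // -pb -rmorphXn.
  rewrite NegzE mulrNz -pmulrn chiN ?pmulrn ?chiX //; last exact: gp_mulrz.
  exists 1, (p ^+ k.+1); rewrite rmorph1 div1r rmorphXn /= pb -chiX //.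
  have Gbk : gp S (b *+ k.+1) by rewrite pmulrn; apply: gp_mulrz.
  split; rewrite ?chi_neq0 // -chiN //; apply: laurent_chi; exact: gpN.
have Qlaurent l : laurent l -> Q l.
  move=> [s [r [Ss ls]]]; have Gs := gpS Ss.
  have -> : l = r%:F * chi (- s).
    by rewrite chiN // chi_pas // -ls mulfK // monF_neq0.
  apply: (QM); last by apply/Qchi/gpN.
  have [us usS ->] := sr_mon_sum RS r; rewrite rmorph_sum big_seq.
  elim/big_ind: _ => [||u /usS Su]; [by rewrite -(rmorph0 theta)|exact: QD|].
  rewrite /= tofracM -chi_pas //; apply: QM; last exact/Qchi/gpS.
  by have [p <-] := thC (cf u r).
have prime_th q : prime_elt q -> prime_in laurent (theta q).
  move=> [q0 qP]; split; [exact: thL|exact: th_neq0|].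
  move=> _ _ /Qlaurent[a [m1 [m10 Lm1 ->]]] /Qlaurent[b [m2 [m20 Lm2 ->]]].
  move=> /Qlaurent[c [m3 [m30 Lm3 e]]].
  have tq0 := th_neq0 _ q0.
  have {}e : a * b * m3 = q * (c * m1 * m2).
    apply/eqP; rewrite -subr_eq0; apply/eqP/th_inj.
    rewrite rmorphB !rmorphM; apply/eqP; rewrite subr_eq0; apply/eqP.
    exact: cross_multiply e.
  have qabm : divides q (a * b * m3) by exists (c * m1 * m2).
  have div_th x m : laurent (theta m)^-1 -> divides q x -> laurent (theta x / theta m / theta q).
    move=> Lm [y ->]; rewrite rmorphM mulrAC [theta q * _]mulrC mulfK //.
    exact: laurentM.
  have [/qP[qa|qb]|[y m3E]] := qP _ _ qabm.
  - by left; apply: div_th.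
  - by right; apply: div_th.
  (* Here [q] divides the denominator [m3], so [theta q] is a Laurent unit and divides
     everything. *)
  left; have -> : theta a / theta m1 / theta q = theta a / theta m1 * (theta y / theta m3).
    have y0 : theta y != 0 by move: m30; rewrite m3E rmorphM mulf_eq0 => /norP[].
    by rewrite m3E rmorphM invfM [theta y * _]mulrCA mulfV // mulr1.
  by apply: laurentM; apply: laurentM.
have Ld (g : F) : D g -> laurent (d * g) by move=> /dD[r _ <-]; apply: laurent_tofrac.
have [p [m [m0 Lm dg0]]] := Qlaurent _ (Ld _ Dg0).
have thp : theta p = theta m * (d * g0) by rewrite dg0 mulrC divfK.
have p0 : p != 0.
  apply/eqP => p0; move/eqP: thp; rewrite p0 rmorph0 eq_sym !mulf_eq0.
  by rewrite (negPf m0) (negPf d0) (negPf g00).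
have [s sP pE] := Pf _ p0.
(* The factor [theta m] clears the denominator of [d * g0], so that [a * g0] is the image of [p]. *)
pose a := theta m * d; have a0 : a != 0 by rewrite mulf_neq0.
have [|||f f0 fP] := @gcd_exists _ laurent laurent1 laurentM [seq theta q | q <- s]
  [set a * g | g in D]%classic.
- by move=> _ /mapP[q /sP qP ->]; apply: prime_th.
- by move=> _ [g Dg <-]; rewrite /a -mulrA; apply: laurentM => //; apply: Ld.
- by exists g0 => //; rewrite big_map -rmorph_prod -pE thp mulrA.
exists (f / a); first by rewrite mulf_neq0 ?invr_neq0.
move=> x; have -> : x * (f / a) = x / a * f by rewrite mulrA mulrAC.
rewrite -fP; split=> [h _ [g Dg <-]|h g Dg].
  by rewrite mulrA divfK //; apply: h.
have -> : x * g = x / a * (a * g) by rewrite mulrA divfK.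
by apply: h; exists g.
Qed.

(** * Reduction to monomial ideals *)

Lemma inverse_ideal_scale (D : set F) (c : F) : c != 0 ->
  inverse_ideal [set c * x | x in D]%classic = [set c^-1 * x | x in inverse_ideal D]%classic.
Proof.
move=> c0; apply/seteqP; split=> x.
  move=> Dx; exists (c * x); last by rewrite mulKf.
  move=> y Dy; rewrite mulrAC mulrC; have := Dx (c * y).
  by rewrite mulrCA mulrA; apply; exists y.
move=> [y Dy <-] _ [z Dz <-].
by rewrite mulrACA mulVf // mul1r; apply: Dy.
Qed.

(** Dividing [D] by its gcd in the Laurent ring preserves divisoriality and makes the gcd
    trivial. *)
Lemma divisorial_monomial (W : seq 'cV[int]_n) (D : set F) :
  (forall x, pas_set S x <-> gp S x /\ {in W, forall w, 0 <= pairing w x}) ->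
  divisorial D -> exists (f : F) b, f != 0 /\
    D = [set f * l | l in lspan (halfspaces S W b)]%classic.
Proof.
move=> WP [[DD DR [g0 Dg0 g00] [d d0 dD]] DE].
have dF0 : d%:F != 0 by rewrite tofrac_eq0.
have [||f f0 fP] := laurent_gcd (D := D); [by exists g0|by exists d%:F|].
pose D1 := [set f^-1 * g | g in D]%classic.
have fV0 : f^-1 != 0 by rewrite invr_neq0.
have DfD1 : D = [set f * l | l in D1]%classic.
  apply/seteqP; split=> x; last by move=> [_ [y Dy <-] <-]; rewrite mulVKf.
  by move=> Dx; exists (f^-1 * x); [exists x|rewrite mulVKf].
have [||||b bE] := lspan_divisorial WP (D := D1); last by exists f, b; rewrite -bE.
- by exists (f^-1 * g0); [exists g0|rewrite mulf_neq0].
- exists (d%:F * f); split; first by rewrite mulf_neq0.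
    by apply/fP => g /dD[r _ <-]; apply: laurent_tofrac.
  by move=> _ [g Dg <-]; rewrite -mulrA mulVKf //; apply: dD.
- by rewrite inverse_ideal_scale // inverse_ideal_scale ?invr_neq0 // DE invrK.
move=> x; rewrite -[x in X in _ <-> X](divfK f0) -fP; split.
  by move=> h g Dg; rewrite -mulrA; apply: h; exists g.
by move=> h _ [g Dg <-]; rewrite mulrA; apply: h.
Qed.

(** * Minimal exponents bound the number of generators *)

Lemma common_denominator (ls : seq F) : {in ls, forall l, laurent l} ->
  exists2 t, pas_set S t & {in ls, forall l, exists q, l * (mon t)%:F = q%:F}.
Proof.
elim: ls => [|l ls IH] lsL; first by exists 0 => //; apply: pas0.
have [|t St tls] := IH; first by move=> h hl; apply: lsL; rewrite inE hl orbT.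
have [s [r [Ss ls']]] : laurent l by apply: lsL; rewrite inE eqxx.
exists (s + t); first exact: pasD.
move=> h; rewrite inE => /orP[/eqP ->|/tls[q hq]].
  by exists (r * mon t); rewrite monD // !tofracM mulrA ls'.
by exists (mon s * q); rewrite monD // !tofracM mulrCA hq.
Qed.

Lemma cfB u f g : cf u (f - g) = cf u f - cf u g.
Proof. by apply/eqP; rewrite eq_sym subr_eq -cfD subrK. Qed.

Lemma cf0_cst (c : K) : cf 0 (cst c) = c.
Proof. by rewrite -[cst c]mulr1 -mon0 cfZ cf_mon ?eqxx ?mulr1 //; apply: pas0. Qed.

(* Coefficients at a minimal element only see the constant term of a scalar. *)
Lemma cfM_minimal (C : set V) v t r q l : minimal S C v -> pas_set S t ->
  l * (mon t)%:F = q%:F -> lspan C l -> cf (v + t) (r * q) = cf 0 r * cf (v + t) q.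
Proof.
move=> [Cv vmin] St lq [_ lC].
have -> : r * q = cst (cf 0 r) * q + (r - cst (cf 0 r)) * q by ring.
rewrite cfD cfZ; suff -> : cf (v + t) ((r - cst (cf 0 r)) * q) = 0 by rewrite addr0.
apply: contrapT => /eqP /cfM[x [y [vxy rx qy]]].
have Cy : C (y - t) by apply: lC; apply/(lsuppE _ St lq); rewrite subrK.
have x0 : x = 0.
  apply: vmin; first exact: cf_pas rx.
  have -> : v - x = y - t by apply/eqP; rewrite subr_eq addrAC eq_sym subr_eq addrC -vxy.
  exact: Cy.
by move: rx; rewrite x0 cfB cf0_cst subrr eqxx.
Qed.

(** [A] holds the constant terms of the coefficients that express the minimal monomials by the
    generators, [B] the coefficients of the generators at the minimal exponents. Their product is
    the identity, of rank at most [size s]. *)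
Lemma minimal_generators (C : set V) (D : set F) (f : F) (us : seq V) (s : seq F) :
  (forall u, C u -> gp S u) -> f != 0 -> D = [set f * l | l in lspan C]%classic ->
  generates s D -> uniq us -> {in us, forall u, minimal S C u} -> (size us <= size s)%N.
Proof.
move=> CG f0 DE sD uus usmin.
have sl i : exists l, (i < size s)%N -> lspan C l /\ s`_i = f * l.
  have [is_|] := ltnP i (size s); last by exists 0.
  have : D s`_i.
    rewrite sD; exists (fun j : 'I_(size s) => (j == Ordinal is_)%:R).
    rewrite (bigD1 (Ordinal is_)) //= eqxx tofrac1 mul1r big1 ?addr0 // => j.
    by move=> /negPf ->; rewrite tofrac0 mul0r.
  by rewrite DE => -[l Cl <-]; exists l.
have [ls lsP] := choice sl.
have [|t1 St1 t1P] := @common_denominator [seq ls i | i <- iota 0 (size s)].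
  by move=> l /mapP[i]; rewrite mem_iota => /lsP[[Ll _] _] ->.
have [|t2 St2 t2P] := @common_shift us; first by move=> u /usmin[/CG].
(* [t1] clears the denominators of the generators and [t2] moves the exponents into S; [t] does both
   and brings the computation into R. *)
pose t := t1 + t2; have St : pas_set S t by apply: pasD.
have Sut u : u \in us -> pas_set S (u + t).
  by move=> /t2P Su; rewrite /t [t1 + t2]addrC addrA; apply: pasD.
have lq i : exists q, (i < size s)%N -> ls i * (mon t)%:F = q%:F.
  have [is_|] := ltnP i (size s); last by exists 0.
  have [|q hq] := t1P (ls i); first by apply/mapP; exists i; rewrite // mem_iota.
  by exists (q * mon t2); rewrite monD // !tofracM mulrA hq.
have [q qP] := choice lq.
have ur u : exists r : 'I_(size s) -> R, u \in us ->
    mon (u + t) = \sum_(i < size s) r i * q i.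
  have [uu|_] := boolP (u \in us); last by exists (fun=> 0).
  have [Cu _] := usmin _ uu; have Gu := CG _ Cu.
  have : D (f * chi u).
    rewrite DE; exists (chi u) => //; split; first exact: laurent_chi.
    by move=> v /(lsupp_chi _ Gu) ->.
  rewrite sD => -[r fu]; exists r => _; apply/eqP.
  rewrite -tofrac_eq -chi_mon //; last exact: Sut.
  rewrite -(inj_eq (mulfI f0)) mulrA fu mulr_suml rmorph_sum /= mulr_sumr.
  apply/eqP/eq_bigr => i _; have [_ ->] := lsP _ (ltn_ord i).
  by rewrite tofracM -(qP _ (ltn_ord i)); ring.
have [r rP] := choice ur.
pose A : 'M[K]_(size us, size s) := \matrix_(i, j) cf 0 (r us`_i j).
pose B : 'M[K]_(size s, size us) := \matrix_(j, i) cf (us`_i + t) (q j).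
have AB : A *m B = 1%:M.
  apply/matrixP => i j; rewrite !mxE.
  have ui : us`_i \in us by apply: mem_nth.
  have uj : us`_j \in us by apply: mem_nth.
  transitivity (cf (us`_j + t) (mon (us`_i + t))).
    rewrite (rP _ ui) cf_sum; apply: eq_bigr => k _; rewrite !mxE.
    have [lC _] := lsP _ (ltn_ord k).
    by rewrite (cfM_minimal _ (usmin _ uj) St (qP _ (ltn_ord k)) lC).
  have eqt : (us`_i + t == us`_j + t) = (us`_i == us`_j) by apply: (inj_eq (addIr t)).
  by rewrite cf_mon; [rewrite eqt nth_uniq|exact: Sut].
have := mxrankM_maxl A B; rewrite AB mxrank1 => /leq_trans; apply.
exact: rank_leq_col.
Qed.

(** * Finiteness of the set of classes *)

Lemma lspan_shift (C : set V) u0 : gp S u0 ->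
  lspan C = [set chi u0 * l | l in lspan [set u | C (u + u0)]]%classic.
Proof.
move=> Gu0; have GNu0 := gpN Gu0; apply/seteqP; split=> x.
  move=> [Lx xC]; exists (chi (- u0) * x).
    have Lu0 := laurent_chi GNu0.
    split; first exact: laurentM.
    move=> u /(lsuppM Lu0 Lx)[v [w [-> /(lsupp_chi _ GNu0) -> xw]]] /=.
    by rewrite addrAC addNr add0r; apply: xC.
  by rewrite mulrA -chiD // subrr chi0 mul1r.
move=> [l [Ll lC] <-]; have Lu0 := laurent_chi Gu0.
split; first exact: laurentM.
move=> u /(lsuppM Lu0 Ll)[v [w [-> /(lsupp_chi _ Gu0) -> lw]]] /=.
by rewrite addrC; apply: lC.
Qed.

Lemma class_of_scale (D E : divisorial_ideal R) (X : set F) (c d : F) :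
  c != 0 -> d != 0 -> val D = [set c * x | x in X]%classic ->
  val E = [set d * x | x in X]%classic -> class_of D = class_of E.
Proof.
move=> c0 d0 DX EX; apply/eqmodP/asboolP; exists (fun x => d / c * x); split.
- rewrite DX EX; split=> [_ [x Xx <-]|x y _ _|_ [x Xx <-]].
  + by exists x => //; rewrite mulrA divfK.
  + by apply: mulfI; rewrite mulf_neq0 ?invr_neq0.
  + by exists (c * x); [exists x|rewrite mulrA divfK].
- by move=> x y _ _; rewrite mulrDr.
- by move=> r x _; rewrite mulrCA.
Qed.

Lemma finite_classes (m : nat) : normal_semigroup (pas_set S) ->
  finite_set [set c : divisor_class R | exists D : divisorial_ideal R,
    class_of D = c /\ exists2 k : nat, mu_is (val D) k & (k <= m)%N]%classic.
Proof.
move=> /normal_forms[W WP]; have [gens gensS gind] := pas_generators S.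
have [B BP] := minimal_near gensS gind WP m.
have [T [code codeP]] := ball_code WP B.
(* A union of translates of S by points of the ball. The ball depends only on [m], so there are
   finitely many such sets. *)
pose Gam (Z : {set T}) := [set u | exists a,
  [/\ gp S a, near W B a 0, code a \in Z & pas_set S (u - a)]]%classic.
pose rel c Z := exists (D : divisorial_ideal R) (g : F), [/\ class_of D = c, g != 0 &
  val D = [set g * x | x in lspan (Gam Z)]%classic].
set X := [set c | _]%classic.
have key c : exists Z, X c -> rel c Z.
  have [[D [Dc [k [[s sk sD] _] km]]]|] := pselect (X c); last by exists finset.set0.
  have /set_mem Ddiv := valP D.
  have [f [b [f0 DE]]] := divisorial_monomial WP Ddiv.
  pose C := halfspaces S W b.
  have [x0 Cx0] : exists x, C x.
    have [[_ _ [x Dx x0] _] _] := Ddiv; move: Dx; rewrite DE => -[l [Ll lC] fl].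
    have [|u lu] := lsupp_neq0 Ll; last by exists u; apply: lC.
    by apply: contraNneq x0 => l0; rewrite -fl l0 mulr0.
  have [u0 u0min _] := minimal_below gensS gind WP Cx0.
  have Gu0 : gp S u0 by case: u0min => -[].
  have minG u : minimal S C u -> gp S u by move=> [[]].
  have near0 u : minimal S C u -> near W B (u - u0) 0.
    move=> umin w wW; rewrite raddf0 subr0 raddfB; apply: (BP b _ u u0 umin u0min w wW).
    move=> us uus usmin; apply: leq_trans km; rewrite -sk.
    by apply: minimal_generators f0 DE sD uus usmin => u' [].
  (* Translation by [-u0] moves all minimal elements of [C] into the ball; [Z] records which points
     of the ball they become. *)
  exists [set z | `[< exists2 u, minimal S C u & code (u - u0) = z >]]%SET => _.
  exists D, (f * chi u0); split=> //; first by rewrite mulf_neq0 // chi_neq0.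
  rewrite DE (lspan_shift _ Gu0).
  have -> : [set u | C (u + u0)]%classic =
      Gam [set z | `[< exists2 u, minimal S C u & code (u - u0) = z >]]%SET.
    apply/seteqP; split=> u /=.
      move=> /(minimal_below gensS gind WP)[r rmin Sr]; exists (r - u0); split.
      - by apply: gpB => //; apply: minG.
      - exact: near0.
      - by rewrite inE; apply/asboolP; exists r.
      - by rewrite opprB addrA.
    move=> [a [Ga Ba]]; rewrite inE => /asboolP[r rmin ra] Sua.
    (* Codes are injective on the ball, so a code in [Z] comes only from a translated minimal
       element. *)
    have {Ba} ar : r - u0 = a.
      apply: codeP ra; apply/mem_set; split=> //; last exact: near0.
      by apply: gpB => //; apply: minG.
    have -> : u + u0 = r + (u - a) by rewrite -ar opprB [u + (_ - _)]addrA subrKC.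
    by apply: halfspacesD => //; case: rmin.
  apply/seteqP; split=> x.
    by move=> [_ [l lC <-] <-]; exists l => //; rewrite mulrA.
  by move=> [l lC <-]; exists (chi u0 * l); [exists l|rewrite mulrA].
have [Z ZP] := choice key.
(* Ideals with the same [Z] are multiples of the same module, hence isomorphic. *)
have Zinj : {in X &, injective Z}.
  move=> c c' /set_mem/ZP[D [g [<- g0 DE]]] /set_mem/ZP[D' [g' [<- g'0 DE']]] ZZ.
  by apply: class_of_scale g0 g'0 DE _; rewrite ZZ.
by rewrite -(eq_finite_set (inj_card_eq Zinj)); apply: finite_finset.
Qed.

End Laurent.

Theorem theorem5p1 (K : fieldType) (n : nat) (S : positiveAffineSemigroup n)
    (hnormal : normal_semigroup (pas_set S)) (m : nat) :
  finite_set [set c : divisor_class (semigroup_algebra K S) |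
    exists D : divisorial_ideal (semigroup_algebra K S),
      class_of D = c /\ exists2 k : nat, mu_is (val D) k & (k <= m)%N].
Proof. exact: (finite_classes (semigroup_algebra_ring K S) m hnormal). Qed.
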